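(* Let $\xi,\xi_1,\xi_2,\ldots$ be i.i.d. real random variables with finite negative mean $\mathbb{E}\xi=-a<0$. Let $S_0=0$, $S_n=\sum_{k=1}^n\xi_k$ for $n\ge 1$, and $\tau=\min\{n\ge 1: S_n\le 0\}$ (which is finite almost surely). Assume that $\mathbb{E}\exp(c\xi)=\infty$ for every $c>0$. Let $g:\mathbb{R}\to\mathbb{R}$ be a function satisfying conditions (C1), (C2), (C3) stated in the context, and suppose that $$\mathbb{E}\exp(g(\xi))<\infty.$$ Then $$\mathbb{E}\exp\big((1-\varepsilon)\,g((a-\delta)\tau)\big)<\infty\quad\text{for any } \varepsilon\in(0,1)\text{ and any }\delta\in(0,a).$$
   Context: Conditions on the function $g:\mathbb{R}\to\mathbb{R}$: (C1) $g$ is positive, increasing and differentiable; (C2) $\lim_{x\to\infty}g'(x)=0$; (C3) there exist a constant $\gamma\in(0,1)$ such that $\int_1^\infty \exp(-(1-\gamma)g(x))\,dx<\infty$, and positive constants $x_0$ and $A$ such that, for all $x,y$ with $x_0<y\le x/2$, one has $g(x)-g(x-y)\le\gamma g(y)+A$ (with the same $\gamma$). *)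

(* Defs.v *)
From HB Require Import structures.
From mathcomp Require Import all_boot all_order all_algebra.
From mathcomp Require Import all_classical all_reals all_analysis.

Set Implicit Arguments.
Unset Strict Implicit.
Unset Printing Implicit Defensive.

Import Order.TTheory GRing.Theory Num.Theory.
Import numFieldNormedType.Exports.

Local Open Scope classical_set_scope.
Local Open Scope ring_scope.

Definition mutually_independent (d : measure_display) (T : measurableType d)
    (R : realType) (P : probability T R) (X : nat -> {RV P >-> R}) : Prop :=
  forall (s : seq nat) (A : nat -> set R),
    uniq s -> (forall i, measurable (A i)) ->
    P [set w | forall i, i \in s -> A i (X i w)]
    = (\prod_(i <- s) distribution P (X i) (A i))%E.

Definition identically_distributed (d : measure_display)
    (T : measurableType d) (R : realType) (P : probability T R)
    (X : nat -> {RV P >-> R}) : Prop :=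
  forall (i j : nat) (A : set R), measurable A ->
    distribution P (X i) A = distribution P (X j) A.

Definition iid (d : measure_display) (T : measurableType d) (R : realType)
    (P : probability T R) (X : nat -> {RV P >-> R}) : Prop :=
  mutually_independent X /\ identically_distributed X.

(* The steps of the walk are X 1, X 2, ...; the variable X 0 is not a step,
   it plays the role of the generic copy of the step. *)
Definition walk (d : measure_display) (T : measurableType d) (R : realType)
    (P : probability T R) (X : nat -> {RV P >-> R}) (n : nat) (w : T) : R :=
  \sum_(1 <= k < n.+1) X k w.

(* None stands for tau = +oo, i.e. the walk never enters ]-oo, 0]. *)
Definition first_descent (d : measure_display) (T : measurableType d)
    (R : realType) (P : probability T R) (X : nat -> {RV P >-> R}) (w : T) :
    option nat :=
  if pselect (exists n, (0 < n)%N && (walk X n w <= 0)) is left h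
  then Some (ex_minn h) else None.

(* Extends f to tau = None by the value +oo, so that a finite integral of
   this function also forces tau to be finite almost surely. *)
Definition at_time (R : realType) (f : R -> R) (t : option nat) : \bar R :=
  if t is Some n then (f n%:R)%:E else +oo%E.

(* "Increasing" is read in the weak sense. *)
Definition C1 (R : realType) (g : R -> R) : Prop :=
  [/\ forall x, 0 < g x,
      {homo g : x y / x <= y} &
      forall x : R, derivable g x 1].

Definition C2 (R : realType) (g : R -> R) : Prop :=
  derive1 g x @[x --> +oo] --> (0 : R).

Definition C3 (R : realType) (g : R -> R) : Prop :=
  exists gamma : R,
    [/\ 0 < gamma < 1,
        (\int[lebesgue_measure]_(x in `[1%R, +oo[)
           (expR (- (1 - gamma) * g x))%:E < +oo)%E &
        exists x0 A : R,
          [/\ 0 < x0, 0 < A &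
              forall x y : R, x0 < y -> y <= x / 2 ->
                g x - g (x - y) <= gamma * g y + A]].

(* Main.v *)
Require Import Defs.
From HB Require Import structures.
From mathcomp Require Import all_boot all_order all_algebra.
From mathcomp Require Import all_classical all_reals all_analysis.
From mathcomp Require Import measurable_realfun ring lra.

Import Order.TTheory GRing.Theory Num.Theory.
Import numFieldNormedType.Exports.

Local Open Scope classical_set_scope.
Local Open Scope ring_scope.

(** Write b = a - delta, S_n for the walk and p_n = P(tau > n).  Everything
    rests on the tail estimate p_n <= C exp (- g (b n)) of [survival_tail].

    From the estimate to the theorem: g (b (n + 1)) exceeds g (b n) by at most
    a constant, so on the event tau = n + 1, of probability p_n - p_(n+1), the
    integrand is at most a constant times exp ((1 - eps) g (b n)), hence at most
    a constant times p_n ^ (eps - 1).  By concavity of t ^ eps,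
    p_n ^ (eps - 1) (p_n - p_(n+1)) <= (p_n ^ eps - p_(n+1) ^ eps) / eps, and
    the right-hand side telescopes.  The loss of eps in the exponent is thus the
    price for integrating the tail, whatever the growth of g.

    The tail estimate is the principle of a single big jump, made uniform.  Fix
    n, put x = b n, and call a step big if it exceeds th x, where th > 0 is
    small but independent of n.  If S_n > 0, then either the small steps add up
    to more than - x, or the big ones add up to more than x
    ([survival_one_big_jump]).

    - The small steps, cut off from below so that their mean stays under -b,
      exceed - x with probability at most exp (- g x), by a Chernoff bound with
      parameter lam = 4 g x / ((a - b) n).  The exponential moment is under
      control ([exp_moment_small_part]) because [C3] implies
      g (2 z) <= (1 + gamma) g z + A: so g z / z decays geometrically along
      doublings, and lam z <= gamma g z + A for all z <= th x
      ([growth_linear_below]).  What remains of the moment is absorbed by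
      E exp (g xi), since z = O (exp ((1 - gamma) g z)) by the integral
      condition ([growth_log]).

    - For the big steps, [C3] reads g (u + v) <= g u + gamma g v + A for v <= u.
      Hence exp g of a sum of big steps is at most exp g of the largest one times
      a factor exp (gamma g + A) for each of the others.  Such a factor has an
      expectation O (1 / n), so the extra big steps cost only a constant factor,
      although there are up to n of them.  The first big step occurs at time
      k + 1 only if the walk is still positive at time k; Markov's inequality
      then bounds the contribution by a constant times
      exp (- g x) (p_0 + ... + p_(n-1)).

    The last sum is bounded because tau has a finite mean, by Wald's identity
    for the steps cut off from below ([sum_survival_le]).  The walk enters only
    through independence of each step from the past, in the form of
    [expect_mul]. *)

(** * Consequences of the growth condition *)

Section Growth.
Context {R : realType}.

(** Positivity, monotonicity and the growth condition, with the constants of the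
    latter as parameters because the estimates below have to share them. *)
Record growth_condition (g : R -> R) (gamma A x0 : R) : Prop := GrowthCondition {
  growth_gt0 : forall x, 0 < g x;
  growth_homo : {homo g : x y / x <= y};
  growth_exponent : 0 < gamma < 1;
  growth_x0_gt0 : 0 < x0;
  growth_A_gt0 : 0 < A;
  growth_increment :
    forall x y, x0 < y -> y <= x / 2 -> g x - g (x - y) <= gamma * g y + A;
  growth_integral : (\int[lebesgue_measure]_(x in `[1%R, +oo[)
     (expR (- (1 - gamma) * g x))%:E < +oo)%E }.

Variables (g : R -> R) (gamma A x0 : R).
Hypothesis G : growth_condition g gamma A x0.

Lemma growth_add u v : x0 < v -> v <= u -> g (u + v) <= g u + gamma * g v + A.
Proof.
have [g_gt0 g_homo /andP[gamma_gt0 gamma_lt1] x0_gt0 A_gt0 g_C3 g_int] := G.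
move=> x0v vu; have := @g_C3 (u + v) v x0v.
by rewrite addrK => /(_ ltac:(lra)); lra.
Qed.

(** Adding [A / gamma] turns the affine recursion
    [g (2 * z) <= (1 + gamma) * g z + A] into a geometric one. *)
Lemma growth_doubling z k : x0 < z ->
  g (2 ^+ k * z) + A / gamma <= (1 + gamma) ^+ k * (g z + A / gamma).
Proof.
have [g_gt0 g_homo /andP[gamma_gt0 gamma_lt1] x0_gt0 A_gt0 g_C3 g_int] := G.
move=> x0z; elim: k => [|k IH]; first by rewrite !expr0 !mul1r.
have z_gt0 : 0 < z by exact: lt_trans x0z.
have pow_ge1 : 1 <= 2 ^+ k :> R by rewrite exprn_ege1// ler1n.
have x0w : x0 < 2 ^+ k * z by nra.
have := growth_add _ _ x0w (lexx _).
have -> : 2 ^+ k.+1 * z = 2 ^+ k * z + 2 ^+ k * z by rewrite exprS; ring.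
rewrite exprS -mulrA; move: (2 ^+ k * z) IH x0w => w IH x0w H.
apply: (@le_trans _ _ ((1 + gamma) * (g w + A / gamma))); last first.
  by rewrite ler_pM2l ?addr_gt0//; exact: IH.
have -> : (1 + gamma) * (g w + A / gamma) = g w + gamma * g w + A + A / gamma.
  by field; rewrite gt_eqF.
by lra.
Qed.

(** As [(1 + gamma) / 2 < 1], the ratio [g z / z] loses a fixed factor at each
    doubling of [z], up to the additive constant; after enough doublings the
    line of slope [D * g x / x] through the origin lies under [gamma * g + A]. *)
Lemma growth_linear_below D : 0 < D ->
  exists2 th, 0 < th & forall x z, x0 < z -> z <= th * x ->
    D * g x * z <= x * (gamma * g z + A).
Proof.
have [g_gt0 g_homo /andP[gamma_gt0 gamma_lt1] x0_gt0 A_gt0 g_C3 g_int] := G.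
move=> D_gt0; pose r := (1 + gamma) / 2.
have r_ge0 : 0 <= r by rewrite /r; lra.
have [k rk] : exists k, 2 * D * r ^+ k <= gamma.
  have /cvgrPdist_le /(_ (gamma / (2 * D))) : r ^+ n @[n --> \oo] --> (0 : R).
    by apply: cvg_expr; rewrite ger0_norm// /r; lra.
  case=> [|k _ /(_ k (leqnn k))/=]; first by apply: divr_gt0; lra.
  rewrite sub0r normrN ger0_norm ?exprn_ge0// ler_pdivlMr; last by lra.
  by exists k; rewrite mulrC.
have pow_gt0 i : 0 < 2 ^+ i :> R by rewrite exprn_gt0.
exists (2 ^- k); first by rewrite invr_gt0.
move=> x z x0z; rewrite mulrC ler_pdivlMr// => zx.
have z_gt0 : 0 < z by exact: lt_trans x0z.
have xz_ge : 2 ^+ k <= x / z by rewrite ler_pdivlMr// mulrC.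
pose m := Num.truncn (x / z).
have km : (2 ^ k <= m)%N.
  by rewrite /m -(@natrK R (2 ^ k)) le_truncn// natrX.
have m_gt0 : (0 < m)%N by rewrite (leq_trans _ km)// expn_gt0.
(* So 2 ^ j z <= x <= 2 ^ (j + 1) z. *)
pose j := trunc_log 2 m.
have kj : (k <= j)%N by exact: trunc_log_max.
have jx : 2 ^+ j * z <= x.
  rewrite -ler_pdivlMr// (@le_trans _ _ m%:R)//; last first.
    by rewrite truncn_le divr_ge0// ltW// (lt_le_trans _ zx)// mulr_gt0.
  by rewrite -natrX ler_nat trunc_logP.
have xj : x <= 2 ^+ j.+1 * z.
  rewrite -ler_pdivrMr// ltW// (lt_le_trans (truncnS_gt _))//.
  by rewrite -natrX ler_nat trunc_log_ltn.
have gx : g x <= (1 + gamma) ^+ j.+1 * (g z + A / gamma).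
  apply: le_trans (growth_doubling z j.+1 x0z).
  by rewrite (le_trans (g_homo _ _ xj))// lerDl divr_ge0// ltW.
have c_ge0 : 0 <= g z + A / gamma by rewrite addr_ge0 ?divr_ge0// ltW.
have -> : x * (gamma * g z + A) = x * (gamma * (g z + A / gamma)).
  by field; rewrite gt_eqF.
have powE : (1 + gamma) ^+ j.+1 = (1 + gamma) * r ^+ j * 2 ^+ j.
  by rewrite /r exprS -mulrA -exprMn divfK.
have rj : r ^+ j <= r ^+ k by apply: ler_wiXn2l => //; rewrite /r; lra.
have rj_ge0 : 0 <= r ^+ j by rewrite exprn_ge0.
apply: (@le_trans _ _ (D * ((1 + gamma) * r ^+ j * (g z + A / gamma)) * x)).
  apply: (@le_trans _ _ (D * ((1 + gamma) ^+ j.+1 * (g z + A / gamma)) * z)).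
    by rewrite ler_pM2r// ler_pM2l.
  rewrite powE.
  have -> : D * ((1 + gamma) * r ^+ j * 2 ^+ j * (g z + A / gamma)) * z =
    (D * ((1 + gamma) * r ^+ j * (g z + A / gamma))) * (2 ^+ j * z) by ring.
  by apply: ler_wpM2l => //; rewrite !mulr_ge0//; lra.
rewrite [leRHS]mulrC; apply: ler_wpM2r.
  by rewrite (le_trans _ jx)// mulr_ge0// ltW.
rewrite mulrA; apply: ler_wpM2r => //.
apply: le_trans rk; rewrite mulrA; have Dj : 0 <= D * (r ^+ k) by nra.
have : D * r ^+ j <= D * r ^+ k by rewrite ler_pM2l.
have : 0 <= D * r ^+ j by nra.
nra.
Qed.

Lemma growth_sublinear e : 0 < e ->
  exists X, forall x, X <= x -> g x <= e * x.
Proof.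
have [g_gt0 g_homo /andP[gamma_gt0 gamma_lt1] x0_gt0 A_gt0 g_C3 g_int] := G.
move=> e_gt0; pose z := x0 + 1.
have z_gt0 : 0 < z by rewrite /z; lra.
have K_gt0 : 0 < gamma * g z + A by rewrite addr_gt0// mulr_gt0.
pose D := (gamma * g z + A) / (e * z).
have D_gt0 : 0 < D by rewrite divr_gt0// mulr_gt0.
have [th th_gt0 H] := growth_linear_below D D_gt0.
exists (z / th) => x; rewrite ler_pdivrMr// mulrC => zx.
have := H x z ltac:(rewrite /z; lra) zx.
have -> : D * g x * z = (gamma * g z + A) * (g x / e).
  by rewrite /D; field; rewrite !gt_eqF.
by rewrite [leRHS]mulrC ler_pM2l// ler_pdivrMr// mulrC.
Qed.

(** As [g] is nondecreasing, the integrand is at least its value at [z] on all of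
    [[1, z]], so its finite integral bounds [(z - 1) * expR (- (1 - gamma) * g z)]. *)
Lemma growth_log : exists2 B, 0 < B &
  forall z, z <= B * expR ((1 - gamma) * g z).
Proof.
have [g_gt0 g_homo /andP[gamma_gt0 gamma_lt1] x0_gt0 A_gt0 g_C3 g_int] := G.
have gamma1 : 0 <= 1 - gamma by lra.
set F := fun x : R => (expR (- (1 - gamma) * g x))%:E.
have mg : measurable_fun setT g.
  by apply: nondecreasing_measurable => // x y; exact: g_homo.
have mF D : measurable_fun D F.
  apply/measurable_EFinP; apply: measurable_funTS.
  by apply: measurableT_comp => //; apply: measurable_funM.
set I := (\int[_]_(x in _) _)%E in g_int.
have I_ge0 : (0 <= I)%E by apply: integral_ge0 => x _; rewrite lee_fin expR_ge0.
have I_fin : (fine I)%:E = I by rewrite fineK// ge0_fin_numE.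
(* The first summand serves for z > 2, where z <= 2 (z - 1). *)
exists (2 * fine I + 2); first by rewrite ltr_wpDl// mulr_ge0// fine_ge0.
move=> z; have e1 : 1 <= expR ((1 - gamma) * g z).
  by rewrite -[leLHS]expR0 ler_expR mulr_ge0// ltW.
have fI_ge0 : 0 <= fine I by exact: fine_ge0.
have [z_le2|z_gt2] := leP z 2.
  by rewrite (le_trans z_le2)// -[leLHS]mulr1 ler_pM//; lra.
have : ((expR (- (1 - gamma) * g z))%:E * (z - 1)%:E <= I)%E.
  apply: (@le_trans _ _ (\int[lebesgue_measure]_(x in `[1%R, z]) F x)%E).
    have -> : ((expR (- (1 - gamma) * g z))%:E * (z - 1)%:E =
        \int[lebesgue_measure]_(x in `[1%R, z])
          (cst (expR (- (1 - gamma) * g z))%:E) x)%E.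
      rewrite integral_cst//= lebesgue_measure_itv/= lte_fin.
      by rewrite ifT//; lra.
    apply: ge0_le_integral => //.
    - by move=> x _; rewrite lee_fin expR_ge0.
    - exact: mF.
    - move=> x /=; rewrite in_itv/= => /andP[_ xz].
      by rewrite lee_fin ler_expR !mulNr lerN2 ler_wpM2l// g_homo.
  apply: ge0_subset_integral => //; first exact: mF.
  - by move=> x _; rewrite lee_fin expR_ge0.
  - by apply: subset_itvl; rewrite bnd_simp.
rewrite -I_fin -EFinM lee_fin mulNr expRN ler_pdivrMl ?expR_gt0//.
by nra.
Qed.

End Growth.

(** * Independence of a step from the past *)

Section Past.
Context {d : measure_display} {T : measurableType d} {R : realType}.
Context {P : probability T R} (X : nat -> {RV P >-> R}).

(** A pi-system generating the sigma-algebra of the first [m] steps.  Indices start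
    at 1 because [X 0] is not a step. *)
Definition cylinders (m : nat) : set (set T) :=
  [set C | exists2 A : nat -> set R, (forall i, measurable (A i)) &
    C = [set w | forall i, i \in iota 1 m -> A i (X i w)]].

Definition past (m : nat) := g_sigma_algebraType (cylinders m).

Definition adapted (m : nat) {d' : measure_display} {T' : measurableType d'}
    (U : T -> T') : Prop :=
  measurable_fun [set: past m] (U : past m -> T').

Lemma cylinders_setI m : setI_closed (cylinders m).
Proof.
move=> _ _ [A mA ->] [B mB ->]; exists (fun i => A i `&` B i).
  by move=> i; exact: measurableI.
apply/seteqP; split=> [w [wA wB] i im|w wAB].
  by split; [exact: wA|exact: wB].
by split=> i im; have [] := wAB i im.
Qed.

Lemma cylinders_setT m : cylinders m setT.
Proof. by exists (fun=> setT) => //; apply/seteqP; split. Qed.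

Lemma cylinders_le m n : (m <= n)%N -> cylinders m `<=` cylinders n.
Proof.
move=> mn _ [A mA ->]; exists (fun i => if (i <= m)%N then A i else setT).
  by move=> i; case: ifP.
apply/seteqP; split=> [w wA i|w wA i].
  rewrite mem_iota => /andP[i_gt0 _]; case: ifPn => // im.
  by apply: wA; rewrite mem_iota i_gt0 add1n ltnS.
rewrite mem_iota => /andP[i_gt0]; rewrite add1n ltnS => im.
by have := wA i; rewrite im mem_iota i_gt0 add1n ltnS (leq_trans im mn); exact.
Qed.

Lemma cylinders_measurable m : cylinders m `<=` measurable.
Proof.
move=> _ [A mA ->].
have -> : [set w | forall i, i \in iota 1 m -> A i (X i w)] =
    \bigcap_(i in [set` iota 1 m]) (X i @^-1` A i).
  by apply/seteqP; split=> w wA i; exact: wA.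
apply: bigcap_measurableType => i _.
by rewrite -[_ @^-1` _]setTI; exact: measurable_funP.
Qed.

Lemma past_measurable m : <<s cylinders m >> `<=` measurable.
Proof.
exact: smallest_sub (@sigma_algebra_measurable _ T) (@cylinders_measurable m).
Qed.

Lemma adapted_measurable m d' (T' : measurableType d') (U : T -> T') :
  adapted m U -> measurable_fun setT U.
Proof.
by move=> mU _ B mB; apply: past_measurable; exact: mU measurableT B mB.
Qed.

Lemma adapted_le m n d' (T' : measurableType d') (U : T -> T') : (m <= n)%N -> adapted m U -> adapted n U.
Proof.
move=> mn mU _ B mB.
exact: sub_sigma_algebra2 (cylinders_le m n mn) _ (mU measurableT B mB).
Qed.

Lemma adapted_step m : adapted m.+1 (X m.+1).
Proof.
move=> _ B mB; rewrite setTI; apply: sub_sigma_algebra.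
exists (fun i => if i == m.+1 then B else setT); first by move=> i; case: ifP.
apply/seteqP; split=> [w wB i _|w wB].
  by case: eqP => // ->.
by have := wB m.+1; rewrite eqxx mem_iota add1n ltnS leqnn; exact.
Qed.

Hypothesis X_iid : iid X.

(** Both sides are finite measures in [D]; independence makes them agree on
    cylinders, hence on the sigma-algebra that cylinders generate. *)
Lemma past_indep m D B : <<s cylinders m >> D -> measurable B ->
  P (D `&` X m.+1 @^-1` B) = (P D * distribution P (X 0) B)%E.
Proof.
move=> mD mB; have [X_ind X_id] := X_iid.
have mXB : measurable (X m.+1 @^-1` B).
  by rewrite -[_ @^-1` _]setTI; exact: measurable_funP.
have p_ge0 : 0 <= fine (distribution P (X 0) B) by exact: fine_ge0.
pose p := NngNum p_ge0.
have pE : (fine (distribution P (X 0) B))%:E = distribution P (X 0) B.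
  by rewrite fineK// fin_num_measure.
have := @g_sigma_algebra_measure_unique _ R T (cylinders m)
  (@cylinders_measurable m) (fun=> setT) (fun=> cylinders_setT m) _
  (mrestr P mXB) (mscale p P) (@cylinders_setI m) _ _ D mD.
rewrite /= /mscale /mrestr /= pE muleC => -> //.
- exact: bigcup_const.
- move=> _ [A mA ->].
  pose A' i := if i == m.+1 then B else A i.
  have mA' i : measurable (A' i) by rewrite /A'; case: ifP.
  have iotaS : iota 1 m.+1 = rcons (iota 1 m) m.+1.
    by rewrite -[in LHS](addn1 m) iotaD cats1 add1n.
  have AA' i : i \in iota 1 m -> A' i = A i.
    rewrite mem_iota add1n ltnS => /andP[_ im].
    by rewrite /A' ltn_eqF// ltnS.
  transitivity (P [set w | forall i, i \in iota 1 m.+1 -> A' i (X i w)]).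
    congr (P _); apply/seteqP; split=> [w [wA wB] i|w wA'].
      rewrite iotaS mem_rcons inE => /orP[/eqP ->|im]; first by rewrite /A' eqxx.
      by rewrite AA'//; exact: wA.
    split=> [i im|]; last first.
      by have := wA' m.+1; rewrite iotaS mem_rcons inE eqxx /A' eqxx; exact.
    by rewrite -AA'//; apply: wA'; rewrite iotaS mem_rcons inE im orbT.
  rewrite X_ind ?iota_uniq// X_ind ?iota_uniq// iotaS.
  rewrite -cats1 big_cat/= big_seq1 muleC /A' eqxx (X_id m.+1 0)//.
  congr (_ * _)%E; rewrite !big_seq; apply: eq_bigr => i im.
  by rewrite -/(A' i) AA'.
- by move=> _; rewrite /mrestr (le_lt_trans (probability_le1 _ _)) ?ltry//;
    exact: measurableI.
Qed.

(** The pair formed by the sample point, seen through the past, and the next step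
    has a product law; Tonelli's theorem for that law is the factorization. *)
Lemma expect_mul m (U : T -> R) (f : R -> R) : adapted m U -> (forall w, 0 <= U w) ->
    measurable_fun setT f -> (forall x, 0 <= f x) ->
  (\int[P]_w (U w * f (X m.+1 w))%:E =
   \int[P]_w (U w)%:E * \int[P]_w (f (X 0 w))%:E)%E.
Proof.
move=> mU U_ge0 mf f_ge0.
have mid : measurable_fun setT (idfun : T -> past m).
  by move=> _ B mB; rewrite setTI; exact: (past_measurable m B mB).
pose id_mixin := isMeasurableFun.Build _ _ _ _ _ mid.
pose idm : {mfun T >-> past m} := HB.pack (idfun : T -> past m) id_mixin.
pose phi w : past m * R := (idm w, X m.+1 w).
have mphi : measurable_fun setT phi.
  exact: (measurable_fun_pair mid (measurable_funP (X m.+1))).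
pose F (z : past m * R) := (U z.1 * f z.2)%:E.
have mF : measurable_fun setT F.
  apply/measurable_EFinP; apply: measurable_funM.
    exact: (measurableT_comp mU measurable_fst).
  exact: (measurableT_comp mf measurable_snd).
have F_ge0 z : (0 <= F z)%E by rewrite lee_fin mulr_ge0.
have lawE : forall Y : set (past m * R), measurable Y ->
    (distribution P idm \x distribution P (X 0))%E Y = pushforward P phi Y.
  apply: product_measure_unique => A B mA mB.
  by rewrite /= /pushforward -(past_indep m A B).
transitivity (\int[pushforward P phi]_z F z)%E.
  by rewrite ge0_integral_pushforward.
rewrite (eq_measure_integral (distribution P idm \x distribution P (X 0))%E);
  last by move=> Y mY _; exact/esym/lawE.
rewrite fubini_tonelli1//.
have IfE : (\int[distribution P (X 0)]_y (f y)%:E = \int[P]_w (f (X 0 w))%:E)%E.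
  by rewrite ge0_integral_distribution//; exact/measurable_EFinP.
transitivity (\int[distribution P idm]_x
    ((U x)%:E * \int[P]_w (f (X 0 w))%:E))%E.
  apply: eq_integral => x _; rewrite /fubini_F/= -IfE -ge0_integralZl_EFin//.
  - by move=> y _; rewrite lee_fin.
  - exact/measurable_EFinP.
rewrite ge0_integralZr//.
- by rewrite ge0_integral_distribution//; exact/measurable_EFinP.
- exact/measurable_EFinP.
- by move=> w _; rewrite lee_fin.
- by apply: integral_ge0 => w _; rewrite lee_fin.
Qed.

End Past.

(** * The walk until its first descent *)

Section WalkPast.
Context {d : measure_display} {T : measurableType d} {R : realType}.
Context {P : probability T R} (X : nat -> {RV P >-> R}).
Hypothesis X_iid : iid X.
Local Notation Ex U := (\int[P]_w (U w)%:E)%E.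

Lemma expect_le (U V : T -> R) : measurable_fun setT U ->
    measurable_fun setT V -> (forall w, 0 <= U w) -> (forall w, U w <= V w) ->
  (Ex U <= Ex V)%E.
Proof.
move=> mU mV U_ge0 UV; apply: ge0_le_integral => //.
- by move=> w _; rewrite lee_fin.
- exact/measurable_EFinP.
- exact/measurable_EFinP.
- by move=> w _; rewrite lee_fin.
Qed.

Lemma expect_add (U V : T -> R) : measurable_fun setT U ->
    measurable_fun setT V -> (forall w, 0 <= U w) -> (forall w, 0 <= V w) ->
  Ex (fun w => U w + V w) = (Ex U + Ex V)%E.
Proof.
move=> mU mV U_ge0 V_ge0; rewrite -ge0_integralD//.
- by move=> w _; rewrite lee_fin.
- exact/measurable_EFinP.
- by move=> w _; rewrite lee_fin.
- exact/measurable_EFinP.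
Qed.

Lemma expect_scale k (U : T -> R) : measurable_fun setT U ->
    (forall w, 0 <= U w) -> 0 <= k ->
  Ex (fun w => k * U w) = (k%:E * Ex U)%E.
Proof.
move=> mU U_ge0 k_ge0; rewrite -ge0_integralZl_EFin//.
- by move=> w _; rewrite lee_fin.
- exact/measurable_EFinP.
Qed.

Lemma expect_cst k : Ex (fun=> k) = k%:E.
Proof. by rewrite integral_cst// [X in (_ * X)%E]probability_setT mule1. Qed.

Lemma expect_mul_le m (U : T -> R) (f : R -> R) u v :
    adapted X m U -> (forall w, 0 <= U w) ->
    measurable_fun setT f -> (forall x, 0 <= f x) ->
    (Ex U <= u%:E)%E -> (Ex (f \o X 0) <= v%:E)%E ->
  (Ex (fun w => (U w * f (X m.+1 w))%R) <= (u * v)%:E)%E.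
Proof.
move=> mU U_ge0 mf f_ge0 Uu fv; rewrite (expect_mul X X_iid)// EFinM.
by apply: lee_pmul => //; apply: integral_ge0 => w _; rewrite lee_fin.
Qed.

Lemma measurable_natr_bool {d'} {T' : measurableType d'} (b : T' -> bool) :
  measurable_fun setT b -> measurable_fun setT (fun w => (b w)%:R : R).
Proof.
move=> mb; rewrite [X in measurable_fun _ X](_ : _ =
  (fun w => if b w then 1 else 0 : R)); last by apply/funext => w; case: (b w).
exact: measurable_fun_ifT.
Qed.

Lemma walk0 w : walk X 0 w = 0.
Proof. by rewrite /walk big_geq. Qed.

Lemma walkS m w : walk X m.+1 w = walk X m w + X m.+1 w.
Proof. by rewrite /walk big_nat_recr. Qed.

Lemma adapted_comp_step m (f : R -> R) :
  measurable_fun setT f -> adapted X m.+1 (fun w => f (X m.+1 w)).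
Proof. by move=> mf; apply: measurableT_comp mf _; exact: adapted_step. Qed.

Lemma adapted_succ m d' (T' : measurableType d') (U : T -> T') :
  adapted X m U -> adapted X m.+1 U.
Proof. by apply: adapted_le; exact: leqnSn. Qed.

Lemma adapted_walk m : adapted X m (walk X m).
Proof.
elim: m => [|m IH].
  have -> : walk X 0 = cst 0 by apply/funext => w; rewrite walk0.
  exact: measurable_cst.
have -> : walk X m.+1 = (fun w => walk X m w + X m.+1 w).
  by apply/funext => w; rewrite walkS.
by apply: measurable_funD; [exact: adapted_succ|exact: adapted_step].
Qed.

Fixpoint alive (m : nat) (w : T) : bool :=
  if m is k.+1 then alive k w && (0 < walk X k.+1 w) else true.

Definition survival (m : nat) : R := fine (P [set w | alive m w]).

Lemma adapted_alive m : adapted X m (alive m).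
Proof.
elim: m => [|m IH] /=; first exact: measurable_cst.
apply: measurable_and; first exact: adapted_succ.
by apply: measurable_fun_ltr; [exact: measurable_cst|exact: adapted_walk].
Qed.

Lemma adapted_aliveR m : adapted X m (fun w => (alive m w)%:R : R).
Proof. by apply: measurable_natr_bool; exact: adapted_alive. Qed.

Lemma measurable_alive m : measurable [set w | alive m w].
Proof.
have := @adapted_measurable _ _ _ _ X m _ _ _ (adapted_alive m).
by move=> /(_ measurableT [set true] I); rewrite setTI.
Qed.

Lemma survival_ge0 m : 0 <= survival m.
Proof. exact: fine_ge0. Qed.

Lemma survival_le1 m : survival m <= 1.
Proof.
rewrite /survival -lee_fin fineK; first exact: probability_le1 (measurable_alive m).
by rewrite fin_num_measure//; exact: measurable_alive.
Qed.

Lemma expect_alive m : Ex (fun w => (alive m w)%:R) = (survival m)%:E.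
Proof.
rewrite /survival fineK ?fin_num_measure//; last exact: measurable_alive.
rewrite -[in RHS](setIT [set w | _]) -integral_indic//; last exact: measurable_alive.
by apply: eq_integral => w _; rewrite indicE mem_setE.
Qed.

Lemma walk_gt0_alive m w : (0 < m)%N -> alive m w -> 0 < walk X m w.
Proof. by case: m => [//|m] _ /andP[]. Qed.

(** Wald's identity for the steps cut off at [- N].  Add these steps up to the
    first descent or up to time [n]: before the descent the sum dominates the
    positive walk, and the step of the descent costs at most [N], so the sum never
    falls under [- N].  By independence its mean is at most [- a'] times the sum of
    the survival probabilities.  Adding [N] to each step keeps integrands
    nonnegative. *)
Lemma sum_survival_le N a' n : 0 <= N -> 0 < a' ->
    (Ex (fun w => (Num.max (X 0 w) (- N) + N)%R) <= (N - a')%:E)%E ->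
  \sum_(k < n) survival k <= N / a'.
Proof.
move=> N_ge0 a'_gt0 mean_le.
pose f (x : R) := Num.max x (- N) + N.
have f_ge0 x : 0 <= f x by rewrite /f -lerBlDr sub0r le_max lexx orbT.
have mf : measurable_fun setT f.
  by apply: measurable_funD => //; exact: measurable_maxr.
pose V n w := \sum_(k < n) (alive k w)%:R * f (X k.+1 w).
have mV n' : measurable_fun setT (V n').
  apply: measurable_sum => k; apply: measurable_funM.
    exact: (@adapted_measurable _ _ _ _ X k _ _ _ (adapted_aliveR k)).
  exact: (@adapted_measurable _ _ _ _ X k.+1 _ _ _ (adapted_comp_step k f mf)).
have V_ge0 n' w : 0 <= V n' w.
  by apply: sumr_ge0 => k _; rewrite mulr_ge0.
have VS n' w : V n'.+1 w = V n' w + (alive n' w)%:R * f (X n'.+1 w).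
  by rewrite /V big_ord_recr.
have mA n' : measurable_fun setT (fun w => \sum_(k < n') (alive k w)%:R : R).
  apply: measurable_sum => k.
  exact: (@adapted_measurable _ _ _ _ X k _ _ _ (adapted_aliveR k)).
have V_le n' : (Ex (V n') <= (\sum_(k < n') survival k * (N - a'))%:E)%E.
  elim: n' => [|n' IH].
    rewrite big_ord0 (_ : V 0 = fun=> 0) ?expect_cst//.
    by apply/funext => w; rewrite /V big_ord0.
  rewrite (_ : V n'.+1 = fun w => V n' w + (alive n' w)%:R * f (X n'.+1 w));
    last by apply/funext => w; rewrite VS.
  rewrite expect_add//; last 2 first.
  - apply: measurable_funM.
      exact: (@adapted_measurable _ _ _ _ X n' _ _ _ (adapted_aliveR n')).
    exact: (@adapted_measurable _ _ _ _ X _ _ _ _ (adapted_comp_step n' f mf)).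
  - by move=> w; rewrite mulr_ge0.
  rewrite big_ord_recr EFinD leeD//; apply: expect_mul_le => //.
  - exact: adapted_aliveR.
  - by rewrite expect_alive.
(* V n' minus this multiple is the sum of the cut-off steps so far. *)
have pathwise n' w : - N <= V n' w - N * \sum_(k < n') (alive k w)%:R /\
    (alive n' w -> walk X n' w <= V n' w - N * \sum_(k < n') (alive k w)%:R).
  elim: n' => [|n' [IH1 IH2]].
    by rewrite /V !big_ord0 mulr0 subr0 oppr_le0 walk0.
  have walk_ge0 : alive n' w -> 0 <= walk X n' w.
    by case: (n') => [|k] /=; [rewrite walk0|move=> /andP[_ /ltW]].
  rewrite VS big_ord_recr/= walkS /f.
  case: (alive n' w) IH1 IH2 walk_ge0 => /= [_ /(_ isT) IH2 /(_ isT) w_ge0|IH1 _ _].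
    have : X n'.+1 w <= Num.max (X n'.+1 w) (- N) by rewrite le_max lexx.
    have : - N <= Num.max (X n'.+1 w) (- N) by rewrite le_max lexx orbT.
    by split; lra.
  by split=> //; lra.
have : (Ex (fun w => (N * \sum_(k < n) (alive k w)%:R)%R) <=
    Ex (fun w => (V n w + N)%R))%E.
  apply: expect_le => //.
  - exact: measurable_funM.
  - exact: measurable_funD.
  - by move=> w; rewrite mulr_ge0// sumr_ge0.
  - by move=> w; have [] := pathwise n w; lra.
rewrite expect_add// expect_cst expect_scale//; last first.
  by move=> w; rewrite sumr_ge0.
have -> : Ex (fun w => \sum_(k < n) (alive k w)%:R) =
    (\sum_(k < n) survival k)%:E.
  elim: n => [|n' IH].
    by under eq_integral do rewrite big_ord0; rewrite expect_cst big_ord0.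
  under eq_integral do rewrite big_ord_recr.
  rewrite expect_add//; last 2 first.
  - exact: (@adapted_measurable _ _ _ _ X _ _ _ _ (adapted_aliveR n')).
  - by move=> w; rewrite sumr_ge0.
  by rewrite IH expect_alive big_ord_recr.
move=> /le_trans /(_ (leeD2r _ (V_le n))).
rewrite -EFinM -EFinD lee_fin -mulr_suml ler_pdivlMr//; lra.
Qed.

End WalkPast.

(** * Big steps and small steps *)

Section OneBigJump.
Context {d : measure_display} {T : measurableType d} {R : realType}.
Context {P : probability T R} (X : nat -> {RV P >-> R}).
Hypothesis X_iid : iid X.
Local Notation Ex U := (\int[P]_w (U w)%:E)%E.

Variables (g : R -> R) (gamma A x0 L : R).
Hypotheses (G : growth_condition g gamma A x0) (x0L : x0 <= L).

Definition big_part (x : R) : R := if L < x then x else 0.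
Definition small_part (N x : R) : R := if L < x then 0 else Num.max x (- N).
(** The price of a big step that is not the largest one; [heavy_weight] is the
    price of the largest one. *)
Definition light_weight (x : R) : R :=
  if L < x then expR (gamma * g x + A) else 0.
Definition heavy_weight (x : R) : R := if L < x then expR (g x) else 0.
(** A step multiplies the weights by [tilt]: small steps leave them unchanged. *)
Definition tilt (x : R) : R := light_weight x + (x <= L)%R%:R.

(** [light] and [heavy] dominate [expR (gamma * g W + A)] and [expR (g W)], where
    [W] is the sum of the big steps so far, once there has been a big step.  The
    terms with [alive] start the product at the first big step, and keep track of
    the fact that the walk was positive until then. *)
Fixpoint light (m : nat) (w : T) : R :=
  if m is k.+1 then light k w * tilt (X k.+1 w)
                    + (alive X k w)%:R * light_weight (X k.+1 w)
  else 0.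

Fixpoint heavy (m : nat) (w : T) : R :=
  if m is k.+1 then heavy k w * tilt (X k.+1 w)
                    + (light k w + (alive X k w)%:R) * heavy_weight (X k.+1 w)
  else 0.

Lemma measurable_growth : measurable_fun setT g.
Proof.
by apply: nondecreasing_measurable => // x y; exact: growth_homo G _ _.
Qed.

Lemma measurable_above : measurable_fun setT (fun x : R => L < x).
Proof. by apply: measurable_fun_ltr. Qed.

Lemma measurable_small_part N : measurable_fun setT (small_part N).
Proof.
apply: measurable_fun_ifT => //; first exact: measurable_above.
exact: measurable_maxr.
Qed.

Lemma measurable_light_weight : measurable_fun setT light_weight.
Proof.
apply: measurable_fun_ifT => //; first exact: measurable_above.
apply: measurableT_comp => //; apply: measurable_funD => //.
by apply: measurable_funM => //; exact: measurable_growth.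
Qed.

Lemma measurable_heavy_weight : measurable_fun setT heavy_weight.
Proof.
apply: measurable_fun_ifT => //; first exact: measurable_above.
by apply: measurableT_comp => //; exact: measurable_growth.
Qed.

Lemma measurable_below : measurable_fun setT (fun x : R => (x <= L)%R%:R : R).
Proof. by apply: measurable_natr_bool; exact: measurable_fun_ler. Qed.

Lemma measurable_tilt : measurable_fun setT tilt.
Proof.
by apply: measurable_funD;
  [exact: measurable_light_weight|exact: measurable_below].
Qed.

Lemma light_weight_ge0 x : 0 <= light_weight x.
Proof. by rewrite /light_weight; case: ifP => // _; exact: expR_ge0. Qed.

Lemma heavy_weight_ge0 x : 0 <= heavy_weight x.
Proof. by rewrite /heavy_weight; case: ifP => // _; exact: expR_ge0. Qed.

Lemma tilt_ge0 x : 0 <= tilt x.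
Proof. by rewrite addr_ge0// light_weight_ge0. Qed.

Lemma light_ge0 m w : 0 <= light m w.
Proof.
elim: m => //= m IH.
by rewrite addr_ge0// mulr_ge0// ?tilt_ge0// light_weight_ge0.
Qed.

Lemma heavy_ge0 m w : 0 <= heavy m w.
Proof.
elim: m => //= m IH.
by rewrite addr_ge0// mulr_ge0// ?tilt_ge0// ?heavy_weight_ge0// addr_ge0// light_ge0.
Qed.

Lemma adapted_light m : adapted X m (light m).
Proof.
elim: m => [|m IH] /=; first exact: measurable_cst.
apply: measurable_funD; apply: measurable_funM.
- exact: adapted_succ.
- by apply: adapted_comp_step; exact: measurable_tilt.
- by apply: adapted_succ; exact: adapted_aliveR.
- by apply: adapted_comp_step; exact: measurable_light_weight.
Qed.

Lemma adapted_heavy m : adapted X m (heavy m).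
Proof.
elim: m => [|m IH] /=; first exact: measurable_cst.
apply: measurable_funD; apply: measurable_funM.
- exact: adapted_succ.
- by apply: adapted_comp_step; exact: measurable_tilt.
- apply: measurable_funD; apply: adapted_succ; first exact: adapted_light.
  exact: adapted_aliveR.
- by apply: adapted_comp_step; exact: measurable_heavy_weight.
Qed.

Definition big_sum (m : nat) (w : T) : R :=
  \sum_(1 <= k < m.+1) big_part (X k w).
Definition small_sum (N : R) (m : nat) (w : T) : R :=
  \sum_(1 <= k < m.+1) small_part N (X k w).

Lemma walk_le_split N m w : walk X m w <= big_sum m w + small_sum N m w.
Proof.
rewrite /walk /big_sum /small_sum -big_split/=; apply: ler_sum => k _.
rewrite /big_part /small_part; case: ifP => _; first by rewrite addr0.
by rewrite add0r le_max lexx.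
Qed.

(** Let [v] be a new big step.  If [v <= W], then [expR (g W)] is multiplied by the
    light weight of [v].  If [v > W], then [v] becomes the largest step: its heavy
    weight is multiplied by [expR (gamma * g W + A)], which [light] dominates. *)
Lemma big_sum_weights m w : alive X m w ->
  big_sum m w = 0 \/
  [/\ L < big_sum m w, expR (g (big_sum m w)) <= heavy m w &
      expR (gamma * g (big_sum m w) + A) <= light m w].
Proof.
have [g_gt0 g_homo /andP[gamma_gt0 gamma_lt1] x0_gt0 A_gt0 _ _] := G.
elim: m => [_|m IH]; first by left; rewrite /big_sum big_geq.
move=> /= /andP[am _]; rewrite am; move: (IH am).
have -> : big_sum m.+1 w = big_sum m w + big_part (X m.+1 w).
  by rewrite /big_sum big_nat_recr.
rewrite /tilt /light_weight /heavy_weight /big_part.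
set W := big_sum m w; set v := X m.+1 w.
have l0 := light_ge0 m w; have h0 := heavy_ge0 m w.
case: (ltP L v) => [Lv|vL] => /=; last by rewrite add0r !mulr1 !mulr0 !addr0.
rewrite addr0 => -[->|[LW hW lW]]; right.
  rewrite add0r; split=> //.
  - rewrite mulrDl mul1r addrA lerDr addr_ge0// mulr_ge0//; exact: expR_ge0.
  - by rewrite mul1r lerDr mulr_ge0//; exact: expR_ge0.
have x0v : x0 < v by exact: le_lt_trans Lv.
have x0W : x0 < W by exact: le_lt_trans LW.
have gW := g_gt0 W; have gv := g_gt0 v.
(* This weaker form is symmetric in W and v, and enough for the light weights. *)
have bound_light : g (W + v) <= g W + g v + A.
  have [vW|Wv] := leP v W.
    by have := growth_add _ _ _ _ G W v x0v vW; nra.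
  by have := growth_add _ _ _ _ G v W x0W (ltW Wv); rewrite (addrC v W); nra.
split; first by lra.
- have [vW|Wv] := leP v W.
    have gWv := growth_add _ _ _ _ G W v x0v vW.
    apply: (@le_trans _ _ (heavy m w * expR (gamma * g v + A))); last first.
      by rewrite lerDl mulr_ge0 ?expR_ge0// addr_ge0.
    apply: (@le_trans _ _ (expR (g W) * expR (gamma * g v + A))).
      by rewrite -expRD ler_expR addrA.
    by rewrite ler_wpM2r// expR_ge0.
  have gWv := growth_add _ _ _ _ G v W x0W (ltW Wv).
  apply: (@le_trans _ _ (light m w * expR (g v))); last first.
    rewrite mulrDl addrCA lerDl addr_ge0// ?mulr_ge0// expR_ge0//.
  apply: (@le_trans _ _ (expR (gamma * g W + A) * expR (g v))).
    by rewrite -expRD ler_expR addrC; lra.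
  by rewrite ler_wpM2r// expR_ge0.
- apply: (@le_trans _ _ (light m w * expR (gamma * g v + A))); last first.
    by rewrite lerDl mul1r expR_ge0.
  apply: (@le_trans _ _ (expR (gamma * g W + A) * expR (gamma * g v + A))).
    by rewrite -expRD ler_expR; nra.
  by rewrite ler_wpM2r// expR_ge0.
Qed.

Lemma expect_tilt beta : (Ex (light_weight \o X 0) <= beta%:E)%E ->
  (Ex (tilt \o X 0) <= (1 + beta)%:E)%E.
Proof.
move=> light_le; rewrite /tilt.
rewrite [X in (X <= _)%E](_ : _ =
    Ex (light_weight \o X 0) + Ex (fun w => (X 0 w <= L)%R%:R))%E; last first.
  rewrite -expect_add//.
  - by apply: measurableT_comp => //; exact: measurable_light_weight.
  - by apply: (measurableT_comp measurable_below).
  - by move=> w; exact: light_weight_ge0.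
rewrite addrC EFinD; apply: leeD => //.
rewrite -(@expect_cst _ _ _ P 1); apply: expect_le => //.
  by apply: (measurableT_comp measurable_below).
by move=> w; rewrite lern1 leq_b1.
Qed.

(** Every summand of [light] has a first big step, of mean weight [beta], at a time
    until which the walk is positive, and at most one factor of mean [1 + beta] for
    each later step. *)
Lemma expect_light beta m : 0 <= beta ->
    (Ex (light_weight \o X 0) <= beta%:E)%E ->
  (Ex (light m) <=
    (beta * (1 + beta) ^+ m * \sum_(k < m) survival X k)%:E)%E.
Proof.
move=> beta_ge0 light_le; have tilt_le := expect_tilt beta light_le.
elim: m => [|m IH] /=; first by rewrite expect_cst big_ord0 mulr0.
have s_ge0 : 0 <= \sum_(k < m) survival X k.
  by apply: sumr_ge0 => k _; exact: survival_ge0.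
have p_ge0 := survival_ge0 X m.
have e_ge1 : 1 <= (1 + beta) ^+ m by rewrite exprn_ege1// lerDl.
rewrite expect_add; last 4 first.
- apply: measurable_funM; first exact: (adapted_measurable X m _ _ _ (adapted_light m)).
  exact: (adapted_measurable X m.+1 _ _ _ (adapted_comp_step X m _ measurable_tilt)).
- apply: measurable_funM; first exact: (adapted_measurable X m _ _ _ (adapted_aliveR X m)).
  exact: (adapted_measurable X m.+1 _ _ _
    (adapted_comp_step X m _ measurable_light_weight)).
- by move=> w; rewrite mulr_ge0// ?light_ge0// tilt_ge0.
- by move=> w; rewrite mulr_ge0// light_weight_ge0.
apply: (@le_trans _ _ ((beta * (1 + beta) ^+ m *
    (\sum_(k < m) survival X k)) * (1 + beta) + survival X m * beta)%:E).
  rewrite EFinD; apply: leeD; apply: expect_mul_le => //.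
  - exact: adapted_light.
  - by move=> w; exact: light_ge0.
  - exact: measurable_tilt.
  - exact: tilt_ge0.
  - exact: adapted_aliveR.
  - exact: measurable_light_weight.
  - exact: light_weight_ge0.
  - by rewrite expect_alive.
rewrite lee_fin big_ord_recr/= exprS.
set s := \sum_(k < m) _ in s_ge0 *; set e := (1 + beta) ^+ m in e_ge1 *.
have -> : beta * ((1 + beta) * e) * (s + survival X m) =
  beta * e * s * (1 + beta) + survival X m * beta * ((1 + beta) * e) by ring.
rewrite lerD2l ler_peMr ?mulr_ge0//; nra.
Qed.

(** Compared with [light], one of the at most [m] big steps carries the heavy
    weight, of mean [M]: it is the first one, or one of the others, and then a
    factor [beta] remains for the first. *)
Lemma expect_heavy beta M m : 0 <= beta -> 0 <= M ->
    (Ex (light_weight \o X 0) <= beta%:E)%E ->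
    (Ex (heavy_weight \o X 0) <= M%:E)%E ->
  (Ex (heavy m) <= ((1 + beta) ^+ m * (1 + m%:R * beta) * M *
                    \sum_(k < m) survival X k)%:E)%E.
Proof.
move=> beta_ge0 M_ge0 light_le heavy_le; have tilt_le := expect_tilt beta light_le.
elim: m => [|m IH] /=; first by rewrite expect_cst big_ord0 mulr0.
have s_ge0 : 0 <= \sum_(k < m) survival X k.
  by apply: sumr_ge0 => k _; exact: survival_ge0.
have p_ge0 := survival_ge0 X m.
have e_ge1 : 1 <= (1 + beta) ^+ m by rewrite exprn_ege1// lerDl.
have mlight := adapted_measurable X m _ _ _ (adapted_light m).
have malive := adapted_measurable X m _ _ _ (adapted_aliveR X m).
rewrite expect_add; last 4 first.
- apply: measurable_funM; first exact: (adapted_measurable X m _ _ _ (adapted_heavy m)).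
  exact: (adapted_measurable X m.+1 _ _ _ (adapted_comp_step X m _ measurable_tilt)).
- apply: measurable_funM; first exact: measurable_funD.
  exact: (adapted_measurable X m.+1 _ _ _
    (adapted_comp_step X m _ measurable_heavy_weight)).
- by move=> w; rewrite mulr_ge0// ?heavy_ge0// tilt_ge0.
- by move=> w; rewrite mulr_ge0// ?heavy_weight_ge0// addr_ge0// light_ge0.
apply: (@le_trans _ _ (((1 + beta) ^+ m * (1 + m%:R * beta) * M *
    (\sum_(k < m) survival X k)) * (1 + beta) +
    (beta * (1 + beta) ^+ m * (\sum_(k < m) survival X k) + survival X m) * M)%:E).
  rewrite EFinD; apply: leeD; apply: expect_mul_le => //.
  - exact: adapted_heavy.
  - by move=> w; exact: heavy_ge0.
  - exact: measurable_tilt.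
  - exact: tilt_ge0.
  - by apply: measurable_funD; [exact: adapted_light|exact: adapted_aliveR].
  - by move=> w; rewrite addr_ge0// light_ge0.
  - exact: measurable_heavy_weight.
  - exact: heavy_weight_ge0.
  - rewrite expect_add// ?expect_alive; last by move=> w; exact: light_ge0.
    by rewrite EFinD leeD// expect_light.
rewrite lee_fin big_ord_recr/= exprS -natr1.
set s := \sum_(k < m) _ in s_ge0 *; set e := (1 + beta) ^+ m in e_ge1 *.
have m_ge0 : 0 <= m%:R :> R by [].
rewrite -subr_ge0.
have -> : (1 + beta) * e * (1 + (m%:R + 1) * beta) * M * (s + survival X m) -
  (e * (1 + m%:R * beta) * M * s * (1 + beta) +
   (beta * e * s + survival X m) * M) =
  M * (beta * beta * e * s +
    survival X m * ((1 + beta) * e * (1 + (m%:R + 1) * beta) - 1)) by ring.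
rewrite mulr_ge0// addr_ge0 ?mulr_ge0//; first by lra.
rewrite subr_ge0 -[leLHS]mulr1 ler_pM//; first nra.
by rewrite lerDl mulr_ge0//; lra.
Qed.

Lemma expect_small N lam b q n : 0 <= q ->
    (Ex (fun w => expR (lam * (small_part N (X 0 w) + b))) <= q%:E)%E ->
  (Ex (fun w => expR (lam * (small_sum N n w + b * n%:R))) <= (q ^+ n)%:E)%E.
Proof.
move=> q_ge0 q_bound.
pose f x := expR (lam * (small_part N x + b)).
have mf : measurable_fun setT f.
  apply: measurableT_comp => //; apply: measurable_funM => //.
  by apply: measurable_funD => //; exact: measurable_small_part.
have sumS m w : small_sum N m.+1 w = small_sum N m w + small_part N (X m.+1 w).
  by rewrite /small_sum big_nat_recr.
pose F m w := expR (lam * (small_sum N m w + b * m%:R)).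
suff : adapted X n (F n) /\ (Ex (F n) <= (q ^+ n)%:E)%E by case.
elim: n => [|n [IH1 IH2]].
  have -> : F 0 = fun=> 1.
    by apply/funext => w; rewrite /F /small_sum big_geq// mulr0 addr0 mulr0 expR0.
  by split; [exact: measurable_cst|rewrite expect_cst].
have -> : F n.+1 = fun w => F n w * f (X n.+1 w).
  by apply/funext => w; rewrite /F /f -expRD sumS -natr1; congr expR; ring.
split.
  by apply: measurable_funM; [exact: adapted_succ|exact: adapted_comp_step].
rewrite exprSr; apply: expect_mul_le => // [w|x]; exact: expR_ge0.
Qed.

(** Markov's inequality for [heavy] when the big steps add up to more than
    [b * n], Chernoff's bound for the small steps otherwise. *)
Lemma survival_one_big_jump N lam b q beta M n :
    (0 < n)%N -> 0 <= lam -> 0 <= b -> 0 <= q -> 0 <= beta -> 0 <= M ->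
    (Ex (light_weight \o X 0) <= beta%:E)%E ->
    (Ex (heavy_weight \o X 0) <= M%:E)%E ->
    (Ex (fun w => expR (lam * (small_part N (X 0 w) + b))) <= q%:E)%E ->
  survival X n <=
    expR (- g (b * n%:R)) * ((1 + beta) ^+ n * (1 + n%:R * beta) * M *
                             \sum_(k < n) survival X k) + q ^+ n.
Proof.
move=> n_gt0 lam_ge0 b_ge0 q_ge0 beta_ge0 M_ge0 light_le heavy_le small_le.
have bn_ge0 : 0 <= b * n%:R by rewrite mulr_ge0.
have mheavy := adapted_measurable X n _ _ _ (adapted_heavy n).
have msum : measurable_fun setT (small_sum N n).
  apply: measurable_sum => k.
  by apply: measurableT_comp => //; exact: measurable_small_part.
have msmall : measurable_fun setT
    (fun w => expR (lam * (small_sum N n w + b * n%:R))).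
  apply: measurableT_comp => //; apply: measurable_funM => //.
  exact: measurable_funD.
have mheavy' : measurable_fun setT (fun w => expR (- g (b * n%:R)) * heavy n w).
  exact: measurable_funM.
rewrite -lee_fin -expect_alive.
apply: (@le_trans _ _ (Ex (fun w => (expR (- g (b * n%:R)) * heavy n w +
    expR (lam * (small_sum N n w + b * n%:R)))%R))).
  apply: expect_le => //.
  - exact: (adapted_measurable X n _ _ _ (adapted_aliveR X n)).
  - exact: measurable_funD.
  move=> w; case: (boolP (alive X n w)) => [aw|_]; last first.
    by rewrite addr_ge0 ?expR_ge0// mulr_ge0 ?expR_ge0 ?heavy_ge0.
  (* Without a big step big_sum would be 0, which is not above b n. *)
  have [big|small] := ltP (b * n%:R) (big_sum n w).
    rewrite ler_wpDr ?expR_ge0//.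
    have [W0|[_ hW _]] := big_sum_weights n w aw.
      by move: big; rewrite W0 ltNge bn_ge0.
    rewrite mulrC expRN ler_pdivlMr ?expR_gt0// mul1r (le_trans _ hW)//.
    by rewrite ler_expR (growth_homo _ _ _ _ G)// ltW.
  rewrite ler_wpDl ?mulr_ge0 ?expR_ge0 ?heavy_ge0// -[leLHS]expR0 ler_expR.
  rewrite mulr_ge0//.
  have := walk_gt0_alive X n w n_gt0 aw; have := walk_le_split N n w; lra.
rewrite expect_add//; last first.
  by move=> w; rewrite mulr_ge0 ?expR_ge0 ?heavy_ge0.
rewrite EFinD; apply: leeD; last exact: expect_small.
rewrite expect_scale ?expR_ge0//; last by move=> w; exact: heavy_ge0.
by rewrite EFinM; apply: lee_wpmul2l; [rewrite lee_fin expR_ge0|exact: expect_heavy].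
Qed.

End OneBigJump.

(** * Moments of a single step *)

Section Moments.
Context {d : measure_display} {T : measurableType d} {R : realType}.
Context {P : probability T R} (X : nat -> {RV P >-> R}).
Local Notation Ex U := (\int[P]_w (U w)%:E)%E.

Definition tail_part (U : T -> R) (K : R) (w : T) : R :=
  if K < `|X 0 w| then U w else 0.

Lemma measurable_tail_part U K : measurable_fun setT U ->
  measurable_fun setT (tail_part U K).
Proof.
move=> mU; apply: measurable_fun_ifT => //.
by apply: measurable_fun_ltr => //; exact: measurableT_comp.
Qed.

Lemma tail_part_ge0 U K w : (forall w, 0 <= U w) -> 0 <= tail_part U K w.
Proof. by move=> U_ge0; rewrite /tail_part; case: ifP. Qed.

Lemma expect_tail_small (U : T -> R) e : measurable_fun setT U ->
    (forall w, 0 <= U w) -> (Ex U < +oo)%E -> 0 < e ->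
  exists K0, forall K, K0 <= K -> (Ex (tail_part U K) <= e%:E)%E.
Proof.
move=> mU U_ge0 U_fin e_gt0.
have mEU : measurable_fun setT (EFin \o U) by exact/measurable_EFinP.
pose F n w := (tail_part U n%:R w)%:E.
have mF n : measurable_fun setT (F n).
  by apply/measurable_EFinP; exact: measurable_tail_part.
have [] := @dominated_convergence _ T R P setT measurableT F (cst 0%E)
  (EFin \o U) mF (@measurable_cst _ _ _ _ _ _).
- apply: aeW => w _; apply: cvg_near_cst.
  exists (Num.truncn `|X 0 w|).+1 => // n /= Xn.
  rewrite /F /tail_part ltNge ifN// negbK ltW// (lt_le_trans (truncnS_gt _))//.
  by rewrite ler_nat.
- apply/integrableP; split => //.
  by under eq_integral do rewrite /= ger0_norm//.
- apply: aeW => w n _; rewrite /F /= lee_fin /tail_part.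
  by case: ifP => _; rewrite ?normr0 ?ger0_norm.
move=> _ _; rewrite integral0 => /fine_cvgP[_].
move=> /cvgrPdist_le /(_ e e_gt0) [n0 _ /(_ n0 (leqnn n0))/=].
rewrite sub0r normrN => small; exists n0%:R => K n0K.
apply: (@le_trans _ _ (\int[P]_w F n0 w)%E).
  apply: ge0_le_integral => //.
  - by move=> w _; rewrite lee_fin tail_part_ge0.
  - by apply/measurable_EFinP; exact: measurable_tail_part.
  - move=> w _; rewrite lee_fin /tail_part.
    by case: ltP => [KX|_]; rewrite ?(le_lt_trans n0K KX)//; case: ifP.
have F_ge0 : (0 <= \int[P]_w F n0 w)%E.
  by apply: integral_ge0 => w _; rewrite lee_fin tail_part_ge0.
have F_fin : (\int[P]_w F n0 w)%E \is a fin_num.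
  rewrite ge0_fin_numE//; apply: le_lt_trans U_fin.
  apply: ge0_le_integral => //.
  - by move=> w _; rewrite lee_fin tail_part_ge0.
  - by move=> w _; rewrite lee_fin /tail_part; case: ifP.
rewrite -(fineK F_fin) lee_fin; exact: le_trans (ler_norm _) small.
Qed.

(** Cutting off at [- N] raises the mean by at most the expectation of [`|X 0|]
    outside [[- N, N]].  The shift by [N] makes the integrand nonnegative. *)
Lemma truncated_mean a a' : P.-integrable setT (EFin \o X 0) ->
    (Ex (X 0) = (- a)%:E)%E -> a' < a ->
  exists2 N, 0 <= N &
    (Ex (fun w => Num.max (X 0 w) (- N) + N) <= (N - a')%:E)%E.
Proof.
move=> X_int X_mean a'a.
pose U w : R := `|X 0 w|.
have mU : measurable_fun setT U by exact: measurableT_comp.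
have U_fin : (Ex U < +oo)%E by have /integrableP[_] := X_int.
have [K0 HK0] := expect_tail_small U (a - a') mU (fun w => normr_ge0 _) U_fin
  (ltac:(by rewrite subr_gt0)).
pose N := Num.max K0 0.
have N_ge0 : 0 <= N by rewrite le_max lexx orbT.
exists N => //; have K0N : K0 <= N by rewrite le_max lexx.
have := HK0 N K0N; set V := tail_part U N => V_le.
have mV : measurable_fun setT V by exact: measurable_tail_part.
have V_ge0 w : 0 <= V w by apply: tail_part_ge0 => v; exact: normr_ge0.
have intV : P.-integrable setT (EFin \o V).
  apply/integrableP; split; first exact/measurable_EFinP.
  under eq_integral do rewrite /= ger0_norm//.
  by rewrite (le_lt_trans V_le)// ltry.
have intN := @finite_measure_integrable_cst _ T R P setT N measurableT.
have intXN := integrableD measurableT X_int intN.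
apply: (@le_trans _ _ (\int[P]_w (((X 0 w)%:E + N%:E) + (V w)%:E))%E).
  apply: ge0_le_integral => //.
  - by move=> w _; rewrite lee_fin -lerBlDr sub0r le_max lexx orbT.
  - apply/measurable_EFinP; apply: measurable_funD => //.
    exact: measurable_maxr.
  - apply/measurable_EFinP; apply: measurable_funD => //.
    exact: measurable_funD.
  move=> w _; rewrite -!EFinD lee_fin /V /tail_part /U.
  have [NX|XN] := ltP N `|X 0 w|.
    have [_|X_lt] := lerP (- N) (X 0 w); first by have := normr_ge0 (X 0 w); lra.
    have := ler_norm (- X 0 w); rewrite normrN; lra.
  by rewrite addr0 lerD2r ge_max lexx; move: XN; rewrite ler_norml => /andP[].
rewrite (integralD measurableT intXN intV).
rewrite (integralD measurableT X_int intN) X_mean.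
rewrite [X in (_ + X + _)%E](_ : _ = N%:E)%E; last exact: expect_cst.
apply: (@le_trans _ _ ((- a)%:E + N%:E + (a - a')%:E)%E); first exact: leeD2l.
by rewrite -!EFinD lee_fin; lra.
Qed.

Lemma expR_mul1B_le1 (u : R) : expR u * (1 - u) <= 1.
Proof.
by rewrite mulrC -ler_pdivlMr ?expR_gt0// div1r -expRN expR_ge1Dx.
Qed.

Lemma expR_le_quadratic (u : R) : u <= 1 / 2 -> expR u <= 1 + u + 2 * u ^+ 2.
Proof.
move=> u_le; have u1 : 0 < 1 - u by lra.
rewrite -(ler_pM2r u1); apply: le_trans (expR_mul1B_le1 u) _.
have : 0 <= u ^+ 2 * (1 - 2 * u) by rewrite mulr_ge0 ?sqr_ge0//; lra.
by lra.
Qed.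

(** A first order expansion of the exponential.  The remainder is quadratic on
    [[- K, K]]; on [[K, L]], where [lam * x] may be large, it is at most
    [lam * x * expR (lam * x)], and the growth bounds on [x] and [lam * x]
    multiply to a constant times [expR (g x)]. *)
Lemma expR_small_part (g : R -> R) gamma A x0 (G : growth_condition g gamma A x0)
    B N K L lam x : 0 <= N -> N <= K -> x0 <= K -> 0 <= L -> 0 < lam ->
    lam * K <= 1 / 2 -> 0 < B ->
    (forall z, z <= B * expR ((1 - gamma) * g z)) ->
    (forall z, x0 < z -> z <= L -> lam * z <= gamma * g z + A) ->
  expR (lam * small_part L N x) + lam * N <=
  1 + lam * (Num.max x (- N) + N) + 2 * (lam * K) ^+ 2 +
    lam * (expR A * B) * (if K < `|x| then expR (g x) else 0).
Proof.
move=> N_ge0 NK x0K L_ge0 lam_gt0 lamK B_gt0 HB Hlam.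
have K_ge0 : 0 <= K by lra.
set E := if _ then _ else 0; have E_ge0 : 0 <= lam * (expR A * B) * E.
  rewrite !mulr_ge0 ?expR_ge0//; try exact: ltW.
  by rewrite /E; case: ifP => // _; exact: expR_ge0.
have K2_ge0 : 0 <= (lam * K) ^+ 2 by exact: sqr_ge0.
rewrite /small_part; set m := Num.max x (- N).
have xm : x <= m by rewrite le_max lexx.
have Nm : - N <= m by rewrite le_max lexx orbT.
have [Lx|xL] := ltP L x.
  rewrite mulr0 expR0; have : 0 <= lam * m by rewrite mulr_ge0; lra.
  by lra.
have [mK|Km] := leP m K.
  have bound : `|lam * m| <= lam * K.
    by rewrite normrM gtr0_norm// ler_pM2l// ler_norml mK andbT; lra.
  have lm : lam * m <= 1 / 2 by have := ler_norm (lam * m); lra.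
  have := expR_le_quadratic (lam * m) lm.
  have : (lam * m) ^+ 2 <= (lam * K) ^+ 2.
    by rewrite -(ger0_norm (sqr_ge0 (lam * m))) normrX ler_sqr ?nnegrE// mulr_ge0// ltW.
  by lra.
have mx : m = x.
  rewrite /m max_l// leNgt; apply/negP => xN.
  by have mN : m = - N; [rewrite /m max_r// ltW|rewrite mN in Km; lra].
rewrite mx in Km *.
have KE : E = expR (g x) by rewrite /E gtr0_norm ?Km//; lra.
have x_gt0 : 0 < x by lra.
have e_le : expR (lam * x) <= expR (gamma * g x + A).
  by rewrite ler_expR; apply: Hlam => //; lra.
have first_order : expR (lam * x) <= 1 + lam * x * expR (lam * x).
  by have := expR_mul1B_le1 (lam * x); lra.
have prod_le : x * expR (lam * x) <= expR A * B * expR (g x).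
  apply: (@le_trans _ _ (B * expR ((1 - gamma) * g x) * expR (gamma * g x + A))).
    by apply: ler_pM; rewrite ?expR_ge0// ltW.
  have -> : expR (g x) = expR ((1 - gamma) * g x) * expR (gamma * g x).
    by rewrite -expRD; congr expR; ring.
  by rewrite expRD le_eqVlt; apply/orP; left; apply/eqP; ring.
have : lam * (x * expR (lam * x)) <= lam * (expR A * B * expR (g x)).
  by rewrite ler_pM2l.
have : 0 <= lam * x by rewrite mulr_ge0// ltW.
rewrite KE; lra.
Qed.

End Moments.

(** * The tail of the first descent time *)

Section SurvivalTail.
Context {d : measure_display} {T : measurableType d} {R : realType}.
Context {P : probability T R} (X : nat -> {RV P >-> R}).
Local Notation Ex U := (\int[P]_w (U w)%:E)%E.
Variables (g : R -> R) (gamma A x0 : R).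
Hypothesis G : growth_condition g gamma A x0.

(** [s] is the share of the drift that each of the two error terms of
    [expR_small_part] may consume. *)
Lemma exp_moment_small_part B N K L lam eta s a' b :
    0 <= N -> N <= K -> x0 <= K -> 0 <= L -> 0 < lam ->
    lam * K <= 1 / 2 -> 0 < B ->
    (forall z, z <= B * expR ((1 - gamma) * g z)) ->
    (forall z, x0 < z -> z <= L -> lam * z <= gamma * g z + A) ->
    (Ex (fun w => Num.max (X 0 w) (- N) + N) <= (N - a')%:E)%E ->
    (Ex (tail_part X (fun w => expR (g (X 0 w))) K) <= eta%:E)%E ->
    expR A * B * eta <= s -> 2 * (lam * K ^+ 2) <= s ->
  (Ex (fun w => expR (lam * (small_part L N (X 0 w) + b))) <=
    (expR (- (lam * (a' - b - 2 * s))))%:E)%E.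
Proof.
move=> N_ge0 NK x0K L_ge0 lam_gt0 lamK B_gt0 HB Hlam mean_le tail_le eta_s K_s.
have lam_ge0 : 0 <= lam by exact: ltW.
have AB_ge0 : 0 <= expR A * B by rewrite mulr_ge0 ?expR_ge0// ltW.
have mg := measurable_growth _ _ _ _ G.
have msmall : measurable_fun setT (fun w => small_part L N (X 0 w)).
  by apply: measurableT_comp => //; exact: measurable_small_part.
pose U1 w := expR (lam * small_part L N (X 0 w)).
pose U2 w := Num.max (X 0 w) (- N) + N.
pose U3 := tail_part X (fun w => expR (g (X 0 w))) K.
have mU1 : measurable_fun setT U1.
  by apply: measurableT_comp => //; exact: measurable_funM.
have mU2 : measurable_fun setT U2.
  by apply: measurable_funD => //; exact: measurable_maxr.
have mU3 : measurable_fun setT U3.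
  apply: measurable_tail_part; apply: measurableT_comp => //.
  exact: measurableT_comp.
have U2_ge0 w : 0 <= U2 w.
  by rewrite -lerBlDr sub0r le_max lexx orbT.
have U3_ge0 w : 0 <= U3 w by apply: tail_part_ge0 => v; exact: expR_ge0.
have base : (Ex U1 <= (1 - lam * (a' - 2 * s))%:E)%E.
  have -> : 1 - lam * (a' - 2 * s) = 1 + lam * (N - a' + 2 * s) - lam * N by ring.
  rewrite EFinB leeBrDr//.
  apply: (@le_trans _ _ (Ex (fun w => (1 + 2 * (lam * K) ^+ 2) +
      (lam * U2 w + (lam * (expR A * B)) * U3 w)))).
    rewrite -(@expect_cst _ _ _ P (lam * N)) -expect_add//; last 2 first.
    - by move=> w; exact: expR_ge0.
    - by move=> w; rewrite mulr_ge0.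
    apply: expect_le.
    - exact: measurable_funD.
    - apply: measurable_funD => //; apply: measurable_funD; exact: measurable_funM.
    - by move=> w; rewrite addr_ge0 ?expR_ge0// mulr_ge0.
    move=> w; have := expR_small_part _ _ _ _ G B N K L lam (X 0 w)
      N_ge0 NK x0K L_ge0 lam_gt0 lamK B_gt0 HB Hlam.
    rewrite /U1 /U2 /U3 /tail_part /=.
    by move: (Num.max _ _) (if _ then _ else _) => m v; lra.
  have c_ge0 : 0 <= lam * (expR A * B) by rewrite mulr_ge0.
  rewrite expect_add//; last 3 first.
  - by apply: measurable_funD; exact: measurable_funM.
  - by move=> w; rewrite addr_ge0// mulr_ge0// sqr_ge0.
  - by move=> w; rewrite addr_ge0// mulr_ge0.
  rewrite expect_cst expect_add//; last 4 first.
  - exact: measurable_funM.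
  - exact: measurable_funM.
  - by move=> w; rewrite mulr_ge0.
  - by move=> w; rewrite mulr_ge0.
  rewrite !expect_scale//.
  apply: (@le_trans _ _ ((1 + 2 * (lam * K) ^+ 2)%:E +
      (lam%:E * (N - a')%:E + (lam * (expR A * B))%:E * eta%:E))%E).
    apply: leeD2l; apply: leeD; apply: lee_wpmul2l => //; rewrite lee_fin//.
  rewrite -!EFinM -!EFinD lee_fin.
  have : lam * (expR A * B * eta) <= lam * s by rewrite ler_pM2l.
  have : lam * (2 * (lam * K ^+ 2)) <= lam * s by rewrite ler_pM2l.
  by rewrite exprMn; lra.
rewrite [leLHS](_ : _ = Ex (fun w => expR (lam * b) * U1 w)); last first.
  by apply: eq_integral => w _; rewrite /U1 -expRD; congr (expR _)%:E; ring.
rewrite expect_scale ?expR_ge0//; last by move=> w; exact: expR_ge0.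
apply: (@le_trans _ _ ((expR (lam * b))%:E * (1 - lam * (a' - 2 * s))%:E)%E).
  by apply: lee_wpmul2l => //; rewrite lee_fin expR_ge0.
rewrite -EFinM lee_fin.
have -> : - (lam * (a' - b - 2 * s)) = lam * b + - (lam * (a' - 2 * s)) by ring.
by rewrite expRD ler_pM2l ?expR_gt0// expR_ge1Dx.
Qed.

Lemma expect_heavy_le L M : (Ex (fun w => expR (g (X 0 w))) <= M%:E)%E ->
  (Ex (heavy_weight g L \o X 0) <= M%:E)%E.
Proof.
have mg := measurable_growth _ _ _ _ G.
apply: le_trans; apply: expect_le.
- by apply: measurableT_comp => //; exact: measurable_heavy_weight G.
- by apply: measurableT_comp => //; exact: measurableT_comp.
- by move=> w; exact: heavy_weight_ge0.
- by move=> w; rewrite /= /heavy_weight; case: ifP => // _; exact: expR_ge0.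
Qed.

(** On big steps, [gamma * g] is [g] minus [(1 - gamma) * g], and the latter is
    at least its value at the threshold. *)
Lemma expect_light_le L M : (Ex (fun w => expR (g (X 0 w))) <= M%:E)%E ->
  (Ex (light_weight g gamma A L \o X 0) <=
    (expR A * expR (- ((1 - gamma) * g L)) * M)%:E)%E.
Proof.
have [g_gt0 g_homo /andP[gamma_gt0 gamma_lt1] _ A_gt0 _ _] := G.
have mg := measurable_growth _ _ _ _ G.
have mU : measurable_fun setT (fun w => expR (g (X 0 w))).
  by apply: measurableT_comp => //; exact: measurableT_comp.
move=> M_le.
apply: (@le_trans _ _ (Ex (fun w =>
    (expR A * expR (- ((1 - gamma) * g L))) * expR (g (X 0 w))))).
  apply: expect_le.
  - by apply: measurableT_comp => //; exact: measurable_light_weight G.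
  - exact: measurable_funM.
  - by move=> w; exact: light_weight_ge0.
  move=> w; rewrite /= /light_weight; case: ltP => [Lw|_]; last first.
    by rewrite !mulr_ge0 ?expR_ge0.
  rewrite -!expRD ler_expR.
  have : (1 - gamma) * g L <= (1 - gamma) * g (X 0 w).
    by rewrite ler_wpM2l// ?g_homo ?ltW// subr_gt0.
  by lra.
have k_ge0 : 0 <= expR A * expR (- ((1 - gamma) * g L)).
  by rewrite mulr_ge0 ?expR_ge0.
rewrite expect_scale//.
by rewrite [in leRHS]EFinM; apply: lee_wpmul2l => //; rewrite lee_fin.
Qed.

Hypothesis X_iid : iid X.

(** The gap [de = a - b] between the drift and the slope is divided as follows: half
    of it bounds the cut-off of the steps from below, a quarter the errors in the
    exponential moment, and the last quarter gives the decay of the Chernoff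
    bound, to which [lam] is adjusted. *)
Lemma survival_tail a b : P.-integrable setT (EFin \o X 0) ->
    (Ex (X 0) = (- a)%:E)%E -> (Ex (fun w => expR (g (X 0 w))) < +oo)%E ->
    0 < b -> b < a ->
  exists2 C, 0 < C & forall n, survival X n <= C * expR (- g (b * n%:R)).
Proof.
move=> X_int X_mean g_fin b_gt0 ba.
have [g_gt0 g_homo /andP[gamma_gt0 gamma_lt1] x0_gt0 A_gt0 _ _] := G.
have mg := measurable_growth _ _ _ _ G.
have [B B_gt0 HB] := growth_log _ _ _ _ G.
pose de := a - b; have de_gt0 : 0 < de by rewrite subr_gt0.
pose a' := b + de / 2.
have [N N_ge0 mean_le] : exists2 N, 0 <= N &
    (Ex (fun w => Num.max (X 0 w) (- N) + N) <= (N - a')%:E)%E.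
  by apply: truncated_mean X_int X_mean _; rewrite /a' /de; lra.
pose s := de / 8; have s_gt0 : 0 < s by rewrite divr_gt0.
pose Ug w := expR (g (X 0 w)).
have mUg : measurable_fun setT Ug.
  by apply: measurableT_comp => //; exact: measurableT_comp.
have Ug_ge0 w : 0 <= Ug w by exact: expR_ge0.
pose M := fine (Ex Ug).
have M_ge0 : 0 <= M by apply/fine_ge0/integral_ge0 => w _; rewrite lee_fin.
have M_le : (Ex Ug <= M%:E)%E.
  rewrite /M fineK// ge0_fin_numE//.
  by apply: integral_ge0 => w _; rewrite lee_fin.
have AB_gt0 : 0 < expR A * B by rewrite mulr_gt0 ?expR_gt0.
pose eta := s / (expR A * B); have eta_gt0 : 0 < eta by rewrite divr_gt0.
have [K0 HK0] := expect_tail_small X Ug eta mUg Ug_ge0 g_fin eta_gt0.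
pose K := Num.max K0 (Num.max N x0).
have K_K0 : K0 <= K by rewrite le_max lexx.
have K_N : N <= K by rewrite !le_max lexx !orbT.
have K_x0 : x0 <= K by rewrite !le_max lexx !orbT.
have K_gt0 : 0 < K by exact: lt_le_trans K_x0.
have tail_le := HK0 K K_K0.
(* With this D, lam z = D g x z / x for x = b n: see lamE. *)
pose D := 4 * b / de; have D_gt0 : 0 < D by rewrite divr_gt0// mulr_gt0.
have [th th_gt0 Hth] := growth_linear_below _ _ _ _ G D D_gt0.
(* The smallness of lam that the quadratic error term asks for. *)
pose e := Num.min (1 / (2 * K)) (s / (2 * K ^+ 2)) / D.
have e_gt0 : 0 < e.
  by rewrite divr_gt0// lt_min !divr_gt0// mulr_gt0// exprn_gt0.
have [Xe HXe] := growth_sublinear _ _ _ _ G e e_gt0.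
(* B1 bounds n beta uniformly in n: see nbeta. *)
pose B1 := expR A * M * B / (th * b).
have B1_ge0 : 0 <= B1.
  by rewrite divr_ge0 ?mulr_ge0 ?expR_ge0//; exact: ltW.
pose C1 := expR B1 * (1 + B1) * M * (N / a') + 1.
have a'_gt0 : 0 < a' by rewrite addr_gt0// divr_gt0.
have C1_ge0 : 0 <= expR B1 * (1 + B1) * M * (N / a').
  by rewrite !mulr_ge0 ?expR_ge0 ?addr_ge0 ?invr_ge0// ltW.
pose n0 := (Num.truncn (Num.max (Xe / b) (x0 / (th * b)))).+1.
have large n : (n0 <= n)%N ->
    survival X n <= C1 * expR (- g (b * n%:R)).
  move=> n0n; have n_gt0 : (0 < n)%N by exact: leq_trans n0n.
  have nR_gt0 : 0 < n%:R :> R by rewrite ltr0n.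
  have : Num.max (Xe / b) (x0 / (th * b)) < n%:R.
    by rewrite (lt_le_trans (truncnS_gt _))// ler_nat.
  rewrite gt_max => /andP[]; rewrite ltr_pdivrMr// [n%:R * b]mulrC => xXe.
  rewrite ltr_pdivrMr ?mulr_gt0// => x0n.
  set x := b * n%:R in xXe *; have x_gt0 : 0 < x by rewrite mulr_gt0.
  pose lam := 4 * g x / (de * n%:R).
  have lam_gt0 : 0 < lam by rewrite divr_gt0 ?mulr_gt0.
  have lamE z : lam * z = D * g x * z / x.
    by rewrite /lam /D /x; field; rewrite !gt_eqF.
  have lam_le : lam <= Num.min (1 / (2 * K)) (s / (2 * K ^+ 2)).
    rewrite -[lam]mulr1 lamE mulr1 ler_pdivrMr// mulrC -ler_pdivlMr//.
    by rewrite mulrAC; exact: HXe (ltW xXe).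
  move: lam_le; rewrite le_min ler_pdivlMr ?mulr_gt0// => /andP[lamK].
  rewrite ler_pdivlMr ?mulr_gt0// ?exprn_gt0// => lamK2.
  pose L := th * x; have L_x0 : x0 <= L by rewrite /L /x; lra.
  have lamz z : x0 < z -> z <= L -> lam * z <= gamma * g z + A.
    by move=> x0z zL; rewrite lamE ler_pdivrMr// [leRHS]mulrC; exact: Hth.
  pose q := expR (- (lam * (a' - b - 2 * s))).
  have small_le := exp_moment_small_part B N K L lam eta s a' b N_ge0 K_N K_x0
    (ltac:(lra)) lam_gt0 (ltac:(lra)) B_gt0 HB lamz mean_le tail_le
    (ltac:(by rewrite /eta mulrC divfK// gt_eqF)) (ltac:(lra)).
  pose beta := expR A * expR (- ((1 - gamma) * g L)) * M.
  have beta_ge0 : 0 <= beta by rewrite !mulr_ge0 ?expR_ge0.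
  have light_le := expect_light_le L M M_le.
  have heavy_le := expect_heavy_le L M M_le.
  have := survival_one_big_jump X X_iid g gamma A x0 L G L_x0 N lam b q beta M n
    n_gt0 (ltW lam_gt0) (ltW b_gt0) (expR_ge0 _) beta_ge0 M_ge0 light_le heavy_le
    small_le.
  have -> : q ^+ n = expR (- g x).
    rewrite /q -expRM_natl; congr expR; rewrite /lam /a' /s /x.
    by field; rewrite !gt_eqF.
  have nbeta : n%:R * beta <= B1.
    have : L * expR (- ((1 - gamma) * g L)) <= B.
      by rewrite expRN ler_pdivrMr ?expR_gt0.
    rewrite /B1 /beta ler_pdivlMr ?mulr_gt0// => LB.
    have -> : n%:R * (expR A * expR (- ((1 - gamma) * g L)) * M) * (th * b) =
      expR A * M * (L * expR (- ((1 - gamma) * g L))) by rewrite /L /x; ring.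
    by rewrite ler_wpM2l// mulr_ge0 ?expR_ge0.
  have beta_n : (1 + beta) ^+ n <= expR B1.
    apply: (@le_trans _ _ (expR beta ^+ n)).
      by rewrite lerXn2r ?nnegrE ?expR_ge0 ?addr_ge0// expR_ge1Dx.
    by rewrite -expRM_natl ler_expR.
  have sum_le := sum_survival_le X X_iid N a' n N_ge0 a'_gt0 mean_le.
  have s_ge0 : 0 <= \sum_(k < n) survival X k.
    by apply: sumr_ge0 => k _; exact: survival_ge0.
  move=> /le_trans; apply.
  rewrite /C1 mulrDl mul1r lerD2r mulrC ler_wpM2r ?expR_ge0//.
  rewrite ler_pM ?mulr_ge0 ?exprn_ge0 ?addr_ge0 ?mulr_ge0//.
  rewrite ler_wpM2r// ler_pM ?exprn_ge0 ?addr_ge0 ?mulr_ge0//.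
  by rewrite lerD2l.
exists (C1 + expR (g (b * n0%:R))); first by rewrite addr_gt0 ?expR_gt0// ltr_wpDl.
move=> n; rewrite mulrDl.
have C1e_ge0 : 0 <= C1 * expR (- g (b * n%:R)).
  by rewrite mulr_ge0 ?expR_ge0// addr_ge0.
case: (leqP n0 n) => [n0n|nn0].
  by rewrite ler_wpDr ?mulr_ge0 ?expR_ge0// large.
rewrite ler_wpDl// (le_trans (survival_le1 X n))// -expRD -[leLHS]expR0 ler_expR.
by rewrite subr_ge0 g_homo// ler_pM2l// ler_nat ltnW.
Qed.

End SurvivalTail.

(** * From the tail to the moment *)

(** Young's inequality for [t `^ eps * 1]. *)
Lemma powR_le_affine {R : realType} (eps t : R) : 0 < eps < 1 -> 0 <= t ->
  t `^ eps <= 1 - eps + eps * t.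
Proof.
move=> /andP[e0 e1] t0; have e1' : 0 < 1 - eps by rewrite subr_gt0.
have := @conjugate_powR R (t `^ eps) 1 eps^-1 (1 - eps)^-1 (powR_ge0 _ _) ler01.
rewrite !invr_gt0 e0 e1' !invrK addrC subrK => /(_ isT isT erefl).
rewrite mulr1 powR1 -powRrM mulfV ?gt_eqF// powRr1//; lra.
Qed.

(** Concavity of [t `^ eps]: its graph lies under the tangent at [p]. *)
Lemma powR_increment {R : realType} (eps p q : R) : 0 < eps < 1 -> 0 < p ->
  0 <= q -> p `^ (eps - 1) * (p - q) <= eps^-1 * (p `^ eps - q `^ eps).
Proof.
move=> /[dup] eps01 /andP[e0 e1] p0 q0.
have t0 : 0 <= q / p by rewrite divr_ge0// ltW.
have P_gt0 : 0 < p `^ eps by exact: powR_gt0.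
have qE : q `^ eps = p `^ eps * (q / p) `^ eps.
  by rewrite -(powRM eps (ltW p0) t0) mulrCA mulfV ?mulr1// gt_eqF.
have pE : p `^ (eps - 1) = p `^ eps / p.
  have cond : (eps == 1) ==> (p != 0) by rewrite (gt_eqF p0) implybT.
  by rewrite (powRB cond) (powRr1 (ltW p0)).
rewrite qE pE -(ler_pM2l e0) mulrA mulVKf ?gt_eqF//.
have -> : eps * (p `^ eps / p) * (p - q) = p `^ eps * (eps * (1 - q / p)).
  by field; rewrite gt_eqF.
rewrite -[leRHS](_ : p `^ eps * (1 - (q / p) `^ eps) = _); last by ring.
rewrite ler_pM2l//.
by have := powR_le_affine eps (q / p) eps01 t0; lra.
Qed.

Section FirstDescent.
Context {d : measure_display} {T : measurableType d} {R : realType}.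
Context {P : probability T R} (X : nat -> {RV P >-> R}).
Local Notation Ex U := (\int[P]_w (U w)%:E)%E.

Lemma alive_gt0 m k w : alive X m w -> (0 < k <= m)%N -> 0 < walk X k w.
Proof.
elim: m => [_|m IH] /=; first by rewrite leqn0; case: k.
move=> /andP[am wm]; rewrite [(k <= _)%N]leq_eqVlt ltnS andb_orr.
by move=> /orP[/andP[_ /eqP ->]|] //; exact: IH.
Qed.

Definition descends (m : nat) (w : T) : bool := alive X m w && ~~ alive X m.+1 w.

Lemma first_descent_some m w : descends m w -> first_descent X w = Some m.+1.
Proof.
move=> /andP[am]; rewrite /= am /= -leNgt => wm; rewrite /first_descent.
case: pselect => [h|[]]; last by exists m.+1.
congr Some; case: ex_minnP => k /andP[k0 wk] kmin; apply/eqP.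
rewrite eqn_leq kmin ?wm// ltnNge; apply/negP => km.
by have := alive_gt0 m k w am; rewrite k0 km ltNge wk => /(_ isT).
Qed.

Lemma first_descent_none w : (forall m, alive X m w) -> first_descent X w = None.
Proof.
move=> aw; rewrite /first_descent; case: pselect => // h; exfalso.
have [m /andP[m0]] := h.
by rewrite leNgt (alive_gt0 m m w (aw m))// m0 leqnn.
Qed.

Lemma descends_unique m n w : descends m w -> descends n w -> m = n.
Proof.
by move=> /first_descent_some + /first_descent_some => -> [].
Qed.

Lemma descends_or_alive w : (forall m, alive X m w) \/ exists m, descends m w.
Proof.
have [aw|nall] := pselect (forall m, alive X m w); first by left.
move: nall => /existsNP[m].
elim: m => [//|m IH] nam; have [am|/negP nam'] := boolP (alive X m w).
  by right; exists m; rewrite /descends am; apply/negP.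
exact: IH.
Qed.

Lemma measurable_descends m : measurable_fun setT (descends m).
Proof.
apply: measurable_and; last apply: measurable_neg.
all: exact: (adapted_measurable X _ _ _ _ (adapted_alive X _)).
Qed.

Lemma expect_descends m :
  Ex (fun w => (descends m w)%:R) = (survival X m - survival X m.+1)%:E.
Proof.
have malive k : measurable_fun setT (fun w => (alive X k w)%:R : R).
  exact: (adapted_measurable X k _ _ _ (adapted_aliveR X k)).
have mdesc : measurable_fun setT (fun w => (descends m w)%:R : R).
  by apply: measurable_natr_bool; exact: measurable_descends.
rewrite EFinB -(expect_alive X m) (_ : (\int[P]_w (alive X m w)%:R%:E)%E =
  Ex (fun w => (descends m w)%:R + (alive X m.+1 w)%:R)).
  by rewrite expect_add// expect_alive addeK.
apply: eq_integral => w _; rewrite /descends /=.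
by case: (alive X m w); case: (0 < walk X m.+1 w); rewrite /= ?add0r ?addr0.
Qed.

Lemma survival_nonincreasing m : survival X m.+1 <= survival X m.
Proof.
rewrite -subr_ge0 -lee_fin -expect_descends.
by apply: integral_ge0 => w _; rewrite lee_fin.
Qed.

Lemma measurable_never_descends : measurable [set w | forall m, alive X m w].
Proof.
rewrite (_ : [set w | _] = \bigcap_m [set w | alive X m w]).
  by apply: bigcapT_measurable => m; exact: measurable_alive.
by apply/seteqP; split=> [w aw m _|w aw m]; [exact: aw|exact: aw m I].
Qed.

Lemma integral_at_time (phi : R -> R) : (forall x, 0 <= phi x) ->
    P [set w | forall m, alive X m w] = 0%E ->
  (\int[P]_w at_time phi (first_descent X w) =
   \sum_(m <oo) Ex (fun w => (phi m.+1%:R * (descends m w)%:R)%R))%E.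
Proof.
move=> phi_ge0 N0.
pose N := [set w | forall m, alive X m w].
have mN : measurable N by exact: measurable_never_descends.
pose F m w := (phi m.+1%:R * (descends m w)%:R)%:E.
have F_ge0 m w : (0 <= F m w)%E by rewrite lee_fin mulr_ge0.
have mF m : measurable_fun setT (F m).
  apply/measurable_EFinP; apply: measurable_funM => //.
  by apply: measurable_natr_bool; exact: measurable_descends.
pose h w := (\sum_(m <oo) F m w)%E.
have mh : measurable_fun setT h.
  rewrite /h; under eq_fun do rewrite -(eq_eseriesl (P := predT))//.
  exact: ge0_emeasurable_sum.
have hE m w : descends m w -> h w = (phi m.+1%:R)%:E.
  move=> dm; rewrite /h (@nneseriesD1 _ _ m)//.
  rewrite eseries0 ?adde0 ?/F ?dm ?mulr1// => k _ km.
  suff -> : descends k w = false by rewrite mulr0.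
  by apply/negP => dk; move: km; rewrite (descends_unique _ _ _ dk dm) eqxx.
pose f w := if w \in N then +oo%E else h w.
have fE w : at_time phi (first_descent X w) = f w.
  rewrite /f; case: ifPn => [/[!inE] Nw|]; first by rewrite first_descent_none.
  rewrite notin_setE => nN; have [//|[m dm]] := descends_or_alive w.
  by rewrite (first_descent_some m w dm) (hE m w dm).
rewrite -integral_nneseries//; last by move=> m w _; exact: F_ge0.
transitivity (\int[P]_w f w)%E; first by apply: eq_integral => w _; exact: fE.
apply: ge0_ae_eq_integral => //.
- apply: measurable_fun_ifT => //; apply: (measurable_fun_bool true).
  by rewrite setTI (_ : _ @^-1` _ = N)//; apply/seteqP; split=> w; [exact: set_mem|exact: mem_set].
- by move=> w _; rewrite /f; case: ifP => // _; apply: nneseries_ge0 => m *; exact: F_ge0.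
- by move=> w _; apply: nneseries_ge0 => m *; exact: F_ge0.
exists N; split => // w /=; rewrite /f; case: ifPn => [/[!inE]//|_].
by move=> /not_implyP[_].
Qed.

(** The bound telescopes in [m]: by the tail estimate, a power of the weight [u m]
    is at most a constant times the inverse power of the survival probability. *)
Lemma expect_descends_le (u : nat -> R) eps C m :
    0 < eps < 1 -> 0 < C -> 0 < u m -> survival X m <= C / u m ->
  u m `^ (1 - eps) * (survival X m - survival X m.+1) <=
  C `^ (1 - eps) / eps * (survival X m `^ eps - survival X m.+1 `^ eps).
Proof.
move=> /[dup] eps01 /andP[e0 e1] C_gt0 u_gt0.
have := survival_ge0 X m.+1; have := survival_nonincreasing m.
have := survival_ge0 X m; set p := survival X m; set q := survival X m.+1.
rewrite le_eqVlt => /orP[/eqP <-|p_gt0] qp q_ge0 pC.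
  by have -> : q = 0 by [apply/eqP; rewrite eq_le qp]; rewrite !subrr !mulr0.
have u_le : u m <= C / p by rewrite ler_pdivlMr// mulrC -ler_pdivlMr.
have e1' : 0 <= 1 - eps by rewrite subr_ge0 ltW.
have pow_le : u m `^ (1 - eps) <= C `^ (1 - eps) * p `^ (eps - 1).
  have -> : C `^ (1 - eps) * p `^ (eps - 1) = (C / p) `^ (1 - eps).
    rewrite powRM ?invr_ge0 ?ltW// -(powR_inv1 (ltW p_gt0)) -powRrM.
    by congr (_ * _ `^ _); ring.
  by apply: ge0_ler_powR => //; rewrite nnegrE ?divr_ge0 ?ltW.
apply: (@le_trans _ _ (C `^ (1 - eps) * p `^ (eps - 1) * (p - q))).
  by rewrite ler_wpM2r// subr_ge0.
rewrite -!mulrA ler_wpM2l ?powR_ge0//.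
exact: powR_increment.
Qed.

End FirstDescent.

(** A shift by [b] can be enlarged until the growth condition applies to it. *)
Lemma growth_shift {R : realType} (g : R -> R) gamma A x0 b :
    growth_condition g gamma A x0 -> 0 < b ->
  exists c, forall x, 0 <= x -> g (x + b) <= g x + c.
Proof.
move=> G b_gt0; have [g_gt0 g_homo /andP[gamma_gt0 gamma_lt1] x0_gt0 A_gt0 _ _] := G.
pose v := b + x0; have x0v : x0 < v by rewrite ltrDr.
exists (g (v + v) + A) => x x_ge0.
have gv := g_gt0 v; have gx := g_gt0 x; have gvv := g_gt0 (v + v).
have gv2 : g v <= g (v + v) by rewrite g_homo// lerDl; rewrite /v; lra.
have [vx|xv] := leP v x.
  have := growth_add _ _ _ _ G x v x0v vx.
  have : g (x + b) <= g (x + v) by rewrite g_homo// lerD2l lerDl ltW.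
  by nra.
have : g (x + b) <= g (v + v) by rewrite g_homo//; rewrite /v in xv *; lra.
by lra.
Qed.

Theorem theorem1 (d : measure_display) (T : measurableType d) (R : realType)
    (P : probability T R) (xi : nat -> {RV P >-> R}) (a : R) (g : R -> R)
    (xi_iid : iid xi)
    (xi_int : P.-integrable [set: T] (EFin \o xi 0%N))
    (xi_mean : ('E_P[xi 0%N] = (- a)%R%:E)%E)
    (a_gt0 : 0 < a)
    (xi_heavy : forall c : R, 0 < c ->
       ('E_P[fun w => expR (c * xi 0%N w)%R] = +oo)%E)
    (gC1 : C1 g) (gC2 : C2 g) (gC3 : C3 g)
    (g_moment : ('E_P[fun w => expR (g (xi 0%N w))%R] < +oo)%E) :
  forall eps delta : R, 0 < eps < 1 -> 0 < delta < a ->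
    (\int[P]_w at_time (fun t => expR ((1 - eps) * g ((a - delta) * t))%R)
                       (first_descent xi w) < +oo)%E.
Proof.
move=> eps delta /[dup] eps01 /andP[e0 e1] /andP[delta_gt0 delta_a].
have [g_gt0 g_homo _] := gC1.
have [gamma [gamma01 g_int [x0 [A [x0_gt0 A_gt0 g_C3]]]]] := gC3.
have G : growth_condition g gamma A x0 by split.
set b := a - delta.
have b_gt0 : 0 < b by rewrite subr_gt0.
have ba : b < a by rewrite /b ltrBlDr ltrDl.
rewrite unlock in xi_mean g_moment.
have [C C_gt0 HC] := survival_tail xi g gamma A x0 G xi_iid a b xi_int xi_mean
  g_moment b_gt0 ba.
have [B B_gt0 HB] := growth_log _ _ _ _ G.
have [c Hc] := growth_shift g gamma A x0 b G b_gt0.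
have e1' : 0 < 1 - eps by rewrite subr_gt0.
pose u m := expR (g (b * m%:R)).
have u_gt0 m : 0 < u m by exact: expR_gt0.
have tail m : survival xi m <= C / u m by rewrite /u -expRN.
pose N := [set w | forall m, alive xi m w].
have N0 : P N = 0%E.
  have mN : measurable N by exact: measurable_never_descends.
  have N_le m : (P N <= (survival xi m)%:E)%E.
    rewrite /survival fineK ?fin_num_measure//; last exact: measurable_alive.
    apply: le_measure; rewrite ?inE//; first exact: measurable_alive.
    by move=> w; exact.
  apply/eqP; rewrite eq_le measure_ge0 andbT.
  apply/lee_addgt0Pr => e e_gt0; rewrite add0e.
  pose m := (Num.truncn (C * B / (b * e))).+1.
  apply: (le_trans (N_le m)); rewrite lee_fin (le_trans (tail m))//.
  have m_gt0 : 0 < m%:R :> R by rewrite ltr0n.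
  have /ltW : C * B / (b * e) < m%:R by exact: truncnS_gt.
  rewrite ler_pdivrMr ?mulr_gt0// => CB.
  rewrite ler_pdivrMr// -(ler_pM2r B_gt0) (le_trans CB)//.
  have bm : b * m%:R <= B * u m.
    apply: (le_trans (HB _)); rewrite ler_pM2l// ler_expR ler_piMl ?ltW//.
    by move: gamma01; lra.
  have : e * (b * m%:R) <= e * (B * u m) by rewrite ler_pM2l.
  lra.
rewrite integral_at_time//.
pose K := expR ((1 - eps) * c) * (C `^ (1 - eps) / eps).
have K_ge0 : 0 <= K by rewrite mulr_ge0 ?expR_ge0 ?divr_ge0 ?powR_ge0// ltW.
apply: (@le_lt_trans _ _ (K * survival xi 0 `^ eps)%:E); last exact: ltry.
have term m : (\int[P]_w (expR ((1 - eps) * g (b * m.+1%:R)) * (descends xi m w)%:R)%:E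
    <= (K * (survival xi m `^ eps - survival xi m.+1 `^ eps))%:E)%E.
  rewrite expect_scale ?expR_ge0//; last first.
    by apply: measurable_natr_bool; exact: measurable_descends.
  rewrite expect_descends -EFinM lee_fin.
  have dec := survival_nonincreasing xi m.
  apply: (@le_trans _ _ (expR ((1 - eps) * c) *
      (u m `^ (1 - eps) * (survival xi m - survival xi m.+1)))).
    rewrite mulrA ler_wpM2r ?subr_ge0//.
    rewrite /u -expRM -expRD ler_expR [g _ * _]mulrC -mulrDr ler_pM2l//.
    by rewrite addrC -natr1 mulrDr mulr1; apply: Hc; rewrite mulr_ge0// ltW.
  rewrite /K -mulrA ler_wpM2l ?expR_ge0//.
  exact: expect_descends_le.
apply: lime_le.
  apply: is_cvg_nneseries => m _ _; apply: integral_ge0 => w _.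
  by rewrite lee_fin mulr_ge0 ?expR_ge0.
apply: nearW => n.
apply: (@le_trans _ _ (\sum_(0 <= m < n)
    (K * (survival xi m `^ eps - survival xi m.+1 `^ eps))%:E)%E).
  by apply: lee_sum => m _; exact: term.
rewrite sumEFin lee_fin -mulr_sumr ler_wpM2l//.
under eq_bigr do rewrite -opprB.
rewrite sumrN telescope_sumr// opprB lerBlDr lerDl; exact: powR_ge0.
Qed.
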